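(* Let $I$ be a non-degenerate interval and $f:I\to\mathbb{R}$ continuous whose graph $\{(x,f(x)):x\in I\}\subseteq\mathbb{R}^2$ is $\sigma$-monotone. Then the set of points where $f$ has a derivative (finite or infinite) is perfectly dense in $I$, i.e. its intersection with every nonempty open subset of $I$ contains a perfect set.
   Context: A metric space $(X,d)$ is monotone if there are a linear order $<$ on $X$ and $c>0$ with $d(x,y)\le c\,d(x,z)$ whenever $x<y<z$; it is $\sigma$-monotone if it is a countable union of monotone subspaces. The graph carries the Euclidean metric. *)

(* Defs.v *)
From Stdlib Require Import Reals.
From Coquelicot Require Import Coquelicot.
Open Scope R_scope.

Definition is_interval (I : R -> Prop) : Prop :=
  forall x y z, I x -> I z -> x <= y <= z -> I y.

Definition nondegenerate (I : R -> Prop) : Prop :=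
  exists a b, a < b /\ I a /\ I b.

Definition dist2 (p q : R * R) : R :=
  sqrt ((fst p - fst q) ^ 2 + (snd p - snd q) ^ 2).

Definition strict_linear_order_on (M : R * R -> Prop) (lt : R * R -> R * R -> Prop) : Prop :=
  (forall x, M x -> ~ lt x x) /\
  (forall x y z, M x -> M y -> M z -> lt x y -> lt y z -> lt x z) /\
  (forall x y, M x -> M y -> x <> y -> lt x y \/ lt y x).

Definition monotone_set (M : R * R -> Prop) : Prop :=
  exists (lt : R * R -> R * R -> Prop) (c : R),
    strict_linear_order_on M lt /\ 0 < c /\
    forall x y z, M x -> M y -> M z -> lt x y -> lt y z ->
      dist2 x y <= c * dist2 x z.

Definition sigma_monotone (M : R * R -> Prop) : Prop :=
  exists A : nat -> (R * R -> Prop),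
    (forall n, monotone_set (A n)) /\
    (forall p, M p <-> exists n, A n p).

Definition graph_on (I : R -> Prop) (f : R -> R) : R * R -> Prop :=
  fun p => I (fst p) /\ snd p = f (fst p).

Definition has_ext_derivative_on (I : R -> Prop) (f : R -> R) (x : R) : Prop :=
  exists l : Rbar,
    filterlim (fun y => (f y - f x) / (y - x))
      (within (fun y => I y /\ y <> x) (locally x)) (Rbar_locally l).

Definition closed_set (P : R -> Prop) : Prop :=
  forall x, (forall eps, 0 < eps -> exists p, P p /\ Rabs (p - x) < eps) -> P x.

Definition perfect_set (P : R -> Prop) : Prop :=
  (exists p, P p) /\ closed_set P /\
  forall p, P p -> forall eps, 0 < eps ->
    exists q, P q /\ q <> p /\ Rabs (q - p) < eps.

Definition rel_open (I U : R -> Prop) : Prop :=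
  (forall u, U u -> I u) /\
  forall u, U u -> exists eps, 0 < eps /\
    forall y, I y -> Rabs (y - u) < eps -> U y.

(* Main.v *)
Require Import Defs.
From Stdlib Require Import Reals ZArith Lra Lia Classical ClassicalEpsilon.
From Coquelicot Require Import Coquelicot.
Open Scope R_scope.

(** By Baire's theorem one of the monotone pieces is dense in the graph over some segment [[a, b]];
    connectedness identifies its order with [<] or [>], so that on [[a, b]] every chord
    [f u = f v] satisfies [Rabs (f y - f u) <= c (v - u)] for [u < y < v].  If [f] is not constant,
    assume [f a < f b] (otherwise pass to [- f]) and let [G x] be the minimum of [f] on [[x, b]], a
    continuous nondecreasing function.  By Lebesgue's theorem, relative to the measure [dG], the
    limit of [(y - x) / (G y - G x)] as [y] tends to [x] exists and is finite at [dG]-almost every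
    [x], and a set of full [dG]-measure contains a perfect set.  At such [x] one has [f x = G x], and
    the chord inequality on the gaps where [f <> G] shows that [f] has at [x] the same, possibly
    infinite, derivative as [G]. *)

(** Lebesgue measure is the wrong gauge here. The chord condition bounds [f - G] on a gap only by
    the length of the gap, so [G] controls [f] only where gaps are short compared with increments of
    [G]. This may fail where [G] has derivative zero, and for a Cantor function that is almost
    everywhere. With respect to [dG] such points are negligible. Hence the inverted quotient: an
    infinite derivative of [G] becomes the harmless limit 0, and a zero derivative becomes an
    excluded infinite value.

    Measure is encoded by monotone functions: a set is small if some nondecreasing function of small
    total increase grows at least as fast as [G] near each of its points. The rising sun lemma
    produces such functions explicitly. *)

Definition nondecreasing (f : R -> R) : Prop := forall x y, x <= y -> f x <= f y.

(** * Clamping, chaining along a segment, running maxima *)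

Definition clamp (a b x : R) : R := Rmax a (Rmin b x).

Lemma clamp_in a b x : a <= b -> a <= clamp a b x <= b.
Proof. unfold clamp, Rmax, Rmin; intros; repeat destruct Rle_dec; lra. Qed.

Lemma clamp_id a b x : a <= x <= b -> clamp a b x = x.
Proof. unfold clamp, Rmax, Rmin; intros; repeat destruct Rle_dec; lra. Qed.

Lemma clamp_le a b x y : x <= y -> clamp a b x <= clamp a b y.
Proof. unfold clamp, Rmax, Rmin; intros; repeat destruct Rle_dec; lra. Qed.

Lemma clamp_lipschitz a b x y : Rabs (clamp a b x - clamp a b y) <= Rabs (x - y).
Proof.
  unfold clamp, Rmax, Rmin; repeat destruct Rle_dec; split_Rabs; lra.
Qed.

Lemma continuity_eps (f : R -> R) :
  continuity f <->
  forall x eps, 0 < eps -> exists del, 0 < del /\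
    forall y, Rabs (y - x) < del -> Rabs (f y - f x) < eps.
Proof.
  split.
  - intros H x eps He. destruct (H x eps He) as [d [Hd K]].
    exists d; split; [exact Hd|]. intros y Hy.
    destruct (Req_dec y x) as [->|Hn].
    + rewrite Rminus_diag, Rabs_R0; lra.
    + apply (K y). split; [split; [exact Logic.I|auto]|exact Hy].
  - intros H x eps He. destruct (H x eps He) as [d [Hd K]].
    exists d; split; [exact Hd|]. intros y [_ Hy]. apply K, Hy.
Qed.

(** Compactness of [[a, b]] as a supremum argument: the supremum of the points reachable from [a]
    can be passed by one more local step unless it is [b]. *)
Lemma interval_chain (P : R -> R -> Prop) a b :
  a <= b ->
  (forall s t r, P s t -> P t r -> P s r) ->
  (forall t, a <= t <= b -> exists del, 0 < del /\
     forall u v, a <= u -> v <= b -> t - del < u -> u <= v -> v < t + del -> P u v) ->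
  P a b.
Proof.
  intros Hab Htr Hloc.
  assert (HPa : P a a).
  { destruct (Hloc a) as [d [Hd K]]; [lra|]. apply K; lra. }
  destruct (completeness (fun t => a <= t <= b /\ P a t)) as [s [Hub Hlub]].
  { exists b; intros t [Ht _]; lra. }
  { exists a; split; [lra|exact HPa]. }
  assert (Has : a <= s) by (apply Hub; split; [lra|exact HPa]).
  assert (Hsb : s <= b) by (apply Hlub; intros t [Ht _]; lra).
  destruct (Hloc s) as [d [Hd K]]; [lra|].
  destruct (classic (exists t, (a <= t <= b /\ P a t) /\ s - d < t)) as [[t [[Ht HP] Hst]]|Hn].
  - assert (Hts : t <= s) by (apply Hub; split; auto).
    set (v := Rmin b (s + d / 2)).
    assert (Hv : v <= b /\ v <= s + d / 2 /\ s <= v /\ (v = b \/ v = s + d / 2)).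
    { unfold v, Rmin; destruct Rle_dec; lra. }
    assert (HPv : P a v) by (apply Htr with t; [exact HP|apply K; lra]).
    assert (v <= s) by (apply Hub; split; [lra|exact HPv]).
    destruct Hv as [_ [_ [_ [Hv|Hv]]]]; [rewrite Hv in HPv; exact HPv|lra].
  - exfalso. assert (s <= s - d); [|lra].
    apply Hlub; intros t Ht. apply Rnot_lt_le; intro; apply Hn; exists t; auto.
Qed.

Lemma running_max (g : R -> R) b :
  continuity g ->
  exists H : R -> R, forall x, x <= b ->
    (forall y, x <= y <= b -> g y <= H x) /\ (exists z, x <= z <= b /\ g z = H x).
Proof.
  intros Hg.
  (* The premise [x <= b] stands under the existential so that choice yields a function on the whole
     line, with arbitrary values beyond [b]. *)
  assert (K : forall x, exists m, x <= b ->
     (forall y, x <= y <= b -> g y <= m) /\ (exists z, x <= z <= b /\ g z = m)).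
  { intros x. destruct (Rle_dec x b) as [Hx|Hx].
    - destruct (continuity_ab_maj g x b Hx) as [z [Hz1 Hz2]]; [intros; apply Hg|].
      exists (g z); intros _; split; [exact Hz1|exists z; auto].
    - exists 0; intros; lra. }
  exists (fun x => proj1_sig (constructive_indefinite_description _ (K x))).
  intros x. exact (proj2_sig (constructive_indefinite_description _ (K x))).
Qed.

(** * Coverings by monotone functions *)

(** All pairs [u <= v] near [x] are compared, not only those around [x], so the points where this
    holds form an open set. *)
Definition dominated_near (phi G : R -> R) (x : R) : Prop :=
  exists del, 0 < del /\
    forall u v, x - del < u -> u <= v -> v < x + del -> G v - G u <= phi v - phi u.

(* [cov G E m] says that the outer [dG]-measure of [E] is at most [m]: [phi] plays the role of
   the distribution function of [dG] restricted to an open set containing [E]. *)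
Definition cov (G : R -> R) (E : R -> Prop) (m : R) : Prop :=
  exists phi, nondecreasing phi /\ (forall x, 0 <= phi x <= m) /\
    forall x, E x -> dominated_near phi G x.

Definition null (G : R -> R) (E : R -> Prop) : Prop := forall eps, 0 < eps -> cov G E eps.

Lemma dominated_near_add phi psi G x :
  nondecreasing psi -> dominated_near phi G x -> dominated_near (fun t => phi t + psi t) G x.
Proof.
  intros Hn [d [Hd K]]. exists d; split; [exact Hd|].
  intros u v H1 H2 H3. specialize (K u v H1 H2 H3). specialize (Hn u v H2). lra.
Qed.

Lemma cov_nonneg G E m : cov G E m -> 0 <= m.
Proof. intros [phi [_ [Hb _]]]. specialize (Hb 0); lra. Qed.

Lemma cov_incl G (E E' : R -> Prop) m m' :
  (forall x, E x -> E' x) -> m' <= m -> cov G E' m' -> cov G E m.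
Proof.
  intros HE Hm [phi [H1 [H2 H3]]]. exists phi; repeat split; auto.
  - apply H2.
  - specialize (H2 x); lra.
Qed.

Lemma cov_union G (E E' : R -> Prop) m m' :
  cov G E m -> cov G E' m' -> cov G (fun x => E x \/ E' x) (m + m').
Proof.
  intros [phi [H1 [H2 H3]]] [psi [K1 [K2 K3]]].
  exists (fun x => phi x + psi x); repeat split.
  - intros x y Hxy; specialize (H1 x y Hxy); specialize (K1 x y Hxy); lra.
  - specialize (H2 x); specialize (K2 x); lra.
  - specialize (H2 x); specialize (K2 x); lra.
  - intros x [Hx|Hx].
    + apply dominated_near_add; auto.
    + destruct (dominated_near_add psi phi G x H1 (K3 x Hx)) as [d [Hd K]].
      exists d; split; [exact Hd|]. intros u v A B C; specialize (K u v A B C); lra.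
Qed.

Lemma null_incl G (E E' : R -> Prop) : (forall x, E x -> E' x) -> null G E' -> null G E.
Proof. intros H N eps He. apply cov_incl with E' eps; auto; lra. Qed.

Lemma null_union G (E E' : R -> Prop) :
  null G E -> null G E' -> null G (fun x => E x \/ E' x).
Proof.
  intros H K eps He. replace eps with (eps / 2 + eps / 2) by lra.
  apply cov_union; [apply H|apply K]; lra.
Qed.

Lemma null_empty G (E : R -> Prop) : (forall x, ~ E x) -> null G E.
Proof.
  intros H eps He. exists (fun _ => 0); repeat split; try lra.
  - intros x y _; lra.
  - intros x Hx; destruct (H x Hx).
Qed.

Lemma cov_interval G (E : R -> Prop) c d :
  nondecreasing G -> c <= d -> (forall x, E x -> c < x < d) -> cov G E (G d - G c).
Proof.
  intros HG Hcd HE. exists (fun x => G (clamp c d x) - G c); repeat split.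
  - intros x y Hxy. specialize (HG _ _ (clamp_le c d x y Hxy)); lra.
  - destruct (clamp_in c d x Hcd) as [A B]. specialize (HG _ _ A); lra.
  - destruct (clamp_in c d x Hcd) as [A B]. specialize (HG _ _ B); lra.
  - intros x Hx; specialize (HE x Hx). exists (Rmin (x - c) (d - x)).
    split; [apply Rmin_pos; lra|]. intros u v H1 H2 H3.
    pose proof (Rmin_l (x - c) (d - x)); pose proof (Rmin_r (x - c) (d - x)).
    rewrite !clamp_id by lra; lra.
Qed.

(** Continuity of [G] means that [dG] has no atoms; this is what later rules out isolated points. *)
Lemma null_point G c : nondecreasing G -> continuity G -> null G (fun x => x = c).
Proof.
  intros Hm Hc eps He.
  destruct (proj1 (continuity_eps G) Hc c (eps / 2)) as [d [Hd K]]; [lra|].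
  apply cov_incl with (fun x => x = c) (G (c + d / 2) - G (c - d / 2)); auto.
  - pose proof (K (c + d / 2)) as K1. pose proof (K (c - d / 2)) as K2.
    assert (Rabs (c + d / 2 - c) < d) by (split_Rabs; lra).
    assert (Rabs (c - d / 2 - c) < d) by (split_Rabs; lra).
    specialize (K1 ltac:(auto)); specialize (K2 ltac:(auto)).
    split_Rabs; lra.
  - apply cov_interval; auto; intros; lra.
Qed.

Lemma Series_nonneg (a : nat -> R) : (forall n, 0 <= a n) -> ex_series a -> 0 <= Series a.
Proof.
  intros Ha He. rewrite <- (Rmult_0_l (Series a)), <- Series_scal_l.
  apply Series_le; [|exact He]. intros n; specialize (Ha n); lra.
Qed.

(** Masses [eps / 2 ^ (n + 1)] add up to [eps], and a sum of nondecreasing functions grows at least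
    as fast as each summand. *)
Lemma null_countable G (E : nat -> R -> Prop) :
  (forall n, null G (E n)) -> null G (fun x => exists n, E n x).
Proof.
  intros HE eps He.
  set (e := fun n : nat => eps * (/ 2) ^ (S n)).
  assert (Hepos : forall n, 0 < e n).
  { intros n. unfold e. apply Rmult_lt_0_compat; [exact He|apply pow_lt; lra]. }
  assert (Hser : is_series e eps).
  { apply is_series_ext with (fun n => scal (eps / 2) ((/ 2) ^ n)).
    { intros n. unfold e, scal; simpl; unfold mult; simpl. field. }
    assert (Hg : is_series (fun n => (/ 2) ^ n) (/ (1 - / 2))).
    { apply is_series_geom. rewrite Rabs_pos_eq; lra. }
    assert (Hs : is_series (fun n => eps / 2 * (/ 2) ^ n) (eps / 2 * / (1 - / 2)))
      by exact (is_series_scal (eps / 2) _ _ Hg).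
    replace (eps / 2 * / (1 - / 2)) with eps in Hs by field; exact Hs. }
  set (phi := fun n => proj1_sig (constructive_indefinite_description _ (HE n (e n) (Hepos n)))).
  assert (Hphi : forall n, nondecreasing (phi n) /\ (forall x, 0 <= phi n x <= e n) /\
    forall x, E n x -> dominated_near (phi n) G x).
  { intros n. exact (proj2_sig (constructive_indefinite_description _ (HE n (e n) (Hepos n)))). }
  clearbody phi.
  assert (Hex : forall x, ex_series (fun n => phi n x)).
  { intros x. apply (ex_series_le (fun n => phi n x) e); [|exists eps; exact Hser].
    intros n. unfold norm; simpl; unfold abs; simpl.
    destruct (Hphi n) as [_ [H _]]. rewrite Rabs_pos_eq; apply H. }
  assert (Hdiff : forall n u v, u <= v ->
    phi n v - phi n u <= Series (fun k => phi k v) - Series (fun k => phi k u)).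
  { intros n u v Huv. rewrite <- Series_minus by auto.
    assert (Hd : forall k, 0 <= phi k v - phi k u).
    { intros k. destruct (Hphi k) as [H _]. specialize (H u v Huv); lra. }
    assert (Hexd : ex_series (fun k => phi k v - phi k u)).
    { apply (ex_series_minus (fun k => phi k v) (fun k => phi k u)); auto. }
    rewrite (Series_incr_n _ (S n)) by (auto; lia). simpl pred.
    assert (0 <= Series (fun k => phi (S n + k)%nat v - phi (S n + k)%nat u)).
    { apply Series_nonneg.
      - intros k; apply Hd.
      - apply (ex_series_incr_n (fun k => phi k v - phi k u) (S n)); exact Hexd. }
    assert (phi n v - phi n u <= sum_f_R0 (fun k => phi k v - phi k u) n); [|lra].
    destruct n as [|n]; [simpl; lra|]. rewrite tech5.
    assert (0 <= sum_f_R0 (fun k => phi k v - phi k u) n) by (apply cond_pos_sum; exact Hd).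
    lra. }
  exists (fun x => Series (fun n => phi n x)); repeat split.
  - intros u v Huv. specialize (Hdiff 0%nat u v Huv).
    destruct (Hphi 0%nat) as [H _]; specialize (H u v Huv); lra.
  - apply Series_nonneg; [|auto]. intros n; apply (Hphi n).
  - rewrite <- (is_series_unique e eps Hser). apply Series_le; [|exists eps; exact Hser].
    intros n; apply (Hphi n).
  - intros x [n Hx]. destruct (Hphi n) as [_ [_ H]].
    destruct (H x Hx) as [d [Hd K]]. exists d; split; [exact Hd|].
    intros u v A B C. specialize (K u v A B C). specialize (Hdiff n u v B). lra.
Qed.

(** Reflection exchanges left and right, so that the left-hand half of the rising sun argument
    follows from the right-hand one. *)
Lemma cov_reflect G (S : R -> Prop) m :
  cov (fun x => - G (- x)) (fun x => S (- x)) m -> cov G S m.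
Proof.
  intros [phi [H1 [H2 H3]]]. exists (fun x => m - phi (- x)); repeat split.
  - intros x y Hxy. assert (A : - y <= - x) by lra. specialize (H1 _ _ A); lra.
  - specialize (H2 (- x)); lra.
  - specialize (H2 (- x)); lra.
  - intros x Hx. destruct (H3 (- x)) as [d [Hd K]]; [rewrite Ropp_involutive; exact Hx|].
    exists d; split; [exact Hd|]. intros u v A B C.
    specialize (K (- v) (- u)). rewrite !Ropp_involutive in K. lra.
Qed.

(* F. Riesz's rising sun lemma: [H], the running maximum of [F - M G], is constant near the points of [S]. *)
Lemma rising_sun_right F G c d M (S : R -> Prop) :
  continuity F -> continuity G -> nondecreasing F -> nondecreasing G -> c <= d -> 0 < M ->
  (forall x, S x -> c < x < d /\ exists y, x < y <= d /\ M * (G y - G x) < F y - F x) ->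
  cov G S ((F d - F c) / M).
Proof.
  intros cF cG mF mG Hcd HM HS.
  set (g := fun x => F x - M * G x).
  assert (cg : continuity g).
  { apply continuity_minus; [exact cF|apply continuity_scal; exact cG]. }
  destruct (running_max g d cg) as [H HH].
  (* A maximiser [z >= y] also competes for [H y]; if [z < y], then [H x + M * G x <= F z <= F y <=
     H y + M * G y]. *)
  assert (Hmono : forall x y, x <= y -> y <= d -> H x + M * G x <= H y + M * G y).
  { intros x y Hxy Hyd. destruct (HH x) as [_ [z [Hz <-]]]; [lra|].
    destruct (HH y Hyd) as [Hy _]. unfold g in *.
    destruct (Rle_dec y z) as [Hyz|Hyz].
    - specialize (Hy z). specialize (mG x y Hxy). nra.
    - specialize (Hy y). assert (A : z <= y) by lra. specialize (mF z y A).
      assert (B : x <= z) by lra. specialize (mG x z B). nra. }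
  (* Where [H] is constant, this grows exactly like [G]. At [c] it is nonnegative since
     [g c <= H c]; at [d] it is [(F d - F c) / M] since [H d = g d]. *)
  exists (fun x => (H (clamp c d x) + M * G (clamp c d x) - F c) / M); repeat split.
  - intros x y Hxy. pose proof (clamp_in c d y Hcd) as B.
    specialize (Hmono _ _ (clamp_le c d x y Hxy) (proj2 B)).
    unfold Rdiv; apply Rmult_le_compat_r; [left; apply Rinv_0_lt_compat; exact HM|lra].
  - pose proof (clamp_in c d x Hcd) as B.
    specialize (Hmono c _ (proj1 B) (proj2 B)).
    destruct (HH c Hcd) as [Hc _]. specialize (Hc c). unfold g in Hc.
    apply Rdiv_le_0_compat; [lra|exact HM].
  - pose proof (clamp_in c d x Hcd) as B.
    specialize (Hmono _ d (proj2 B)).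
    destruct (HH d) as [_ [z [Hz Hd]]]; [lra|].
    assert (z = d) by lra; subst z. unfold g in Hd.
    unfold Rdiv; apply Rmult_le_compat_r; [left; apply Rinv_0_lt_compat; exact HM|lra].
  - intros x Hx. destruct (HS x Hx) as [Hxcd [y [Hy Hxy]]].
    (* Near [x] the values of [g] stay below [g y], so the points between [u] and [v] add nothing to
       the maximum over [[v, d]], which already sees [y]. *)
    destruct (proj1 (continuity_eps g) cg x (g y - g x)) as [d1 [Hd1 K]]; [unfold g; lra|].
    exists (Rmin d1 (Rmin (x - c) (y - x))).
    split; [repeat apply Rmin_pos; lra|]. intros u v A B C.
    pose proof (Rmin_l d1 (Rmin (x - c) (y - x))).
    pose proof (Rmin_r d1 (Rmin (x - c) (y - x))).
    pose proof (Rmin_l (x - c) (y - x)). pose proof (Rmin_r (x - c) (y - x)).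
    rewrite !clamp_id by lra.
    assert (H u <= H v).
    { destruct (HH v) as [Hv _]; [lra|].
      destruct (HH u) as [_ [z [Hz <-]]]; [lra|].
      destruct (Rle_dec v z); [apply Hv; lra|].
      assert (Hzx : Rabs (z - x) < d1) by (split_Rabs; lra).
      specialize (K z Hzx). specialize (Hv y). split_Rabs; lra. }
    replace (G v - G u) with (M * (G v - G u) / M) by (field; lra).
    unfold Rdiv; rewrite <- Rmult_minus_distr_r.
    apply Rmult_le_compat_r; [left; apply Rinv_0_lt_compat; exact HM|lra].
Qed.

Lemma continuity_reflect F : continuity F -> continuity (fun x => - F (- x)).
Proof.
  intros cF. apply (continuity_opp (fun x => F (- x))).
  apply (continuity_comp Ropp F); [|exact cF].
  intros x. apply derivable_continuous_pt, derivable_pt_opp, derivable_pt_id.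
Qed.

(** Points with a witness [y] to the right and points with one to the left are covered separately,
    the latter by reflection; hence the factor 2. *)
Lemma rising_sun F G c d M (S : R -> Prop) :
  continuity F -> continuity G -> nondecreasing F -> nondecreasing G -> c <= d -> 0 < M ->
  (forall x, S x -> c < x < d /\
     exists y, c <= y <= d /\ M * Rabs (G y - G x) < Rabs (F y - F x)) ->
  cov G S (2 * (F d - F c) / M).
Proof.
  intros cF cG mF mG Hcd HM HS.
  set (SR := fun x => S x /\ exists y, x < y <= d /\ M * (G y - G x) < F y - F x).
  set (SL := fun x => S x /\ exists y, c <= y < x /\ M * (G x - G y) < F x - F y).
  apply cov_incl with (fun x => SR x \/ SL x) ((F d - F c) / M + (F d - F c) / M).
  - intros x Hx. destruct (HS x Hx) as [Hxcd [y [Hy Hxy]]].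
    destruct (Rtotal_order x y) as [L|[->|L]].
    + left; split; [exact Hx|]. exists y; split; [lra|].
      pose proof (mF x y ltac:(lra)); pose proof (mG x y ltac:(lra)).
      rewrite !Rabs_pos_eq in Hxy; lra.
    + rewrite !Rminus_diag, Rabs_R0 in Hxy; lra.
    + right; split; [exact Hx|]. exists y; split; [lra|].
      pose proof (mF y x ltac:(lra)); pose proof (mG y x ltac:(lra)).
      rewrite (Rabs_minus_sym (G y)), (Rabs_minus_sym (F y)), !Rabs_pos_eq in Hxy; lra.
  - lra.
  - apply cov_union.
    + apply rising_sun_right; auto. intros x [Hx Hy]; split; [apply HS; exact Hx|exact Hy].
    + apply cov_reflect.
      replace ((F d - F c) / M) with ((- F (- (- c)) - - F (- (- d))) / M)
        by (rewrite !Ropp_involutive; field; lra).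
      apply (rising_sun_right (fun x => - F (- x)) (fun x => - G (- x)) (- d) (- c)); auto.
      * apply continuity_reflect; exact cF.
      * apply continuity_reflect; exact cG.
      * intros x y Hxy; specialize (mF (- y) (- x)); lra.
      * intros x y Hxy; specialize (mG (- y) (- x)); lra.
      * lra.
      * intros x [Hx [y [Hy Hxy]]]. destruct (HS _ Hx) as [Hcx _].
        split; [lra|]. exists (- y). rewrite Ropp_involutive. split; lra.
Qed.

(** * Relative differentiation of monotone functions *)

Lemma infimum_exists (Q : R -> Prop) m0 :
  Q m0 -> (forall m, Q m -> 0 <= m) ->
  exists e, 0 <= e /\ (forall m, Q m -> e <= m) /\
    (forall eps, 0 < eps -> exists m, Q m /\ m < e + eps).
Proof.
  intros H0 Hpos.
  destruct (completeness (fun z => Q (- z))) as [s [Hub Hlub]].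
  - exists 0. intros z Hz. specialize (Hpos _ Hz); lra.
  - exists (- m0). rewrite Ropp_involutive; exact H0.
  - exists (- s). repeat split.
    + assert (s <= 0); [|lra]. apply Hlub. intros z Hz. specialize (Hpos _ Hz); lra.
    + intros m Hm. assert (- m <= s); [|lra]. apply Hub. rewrite Ropp_involutive; exact Hm.
    + intros eps He. apply NNPP; intro Hn.
      assert (s <= s - eps); [|lra]. apply Hlub. intros z Hz.
      apply Rnot_lt_le; intro L. apply Hn. exists (- z); split; [exact Hz|lra].
Qed.

Lemma outer_measure_exists G a b (E : R -> Prop) :
  nondecreasing G -> a <= b -> (forall x, E x -> a < x < b) ->
  exists e : R -> R, forall x,
    (forall m, cov G (fun z => E z /\ z < x) m -> e x <= m) /\
    (forall eps, 0 < eps -> cov G (fun z => E z /\ z < x) (e x + eps)).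
Proof.
  intros mG Hab HE.
  assert (K : forall x, exists e,
    (forall m, cov G (fun z => E z /\ z < x) m -> e <= m) /\
    (forall eps, 0 < eps -> cov G (fun z => E z /\ z < x) (e + eps))).
  { intros x.
    destruct (infimum_exists (cov G (fun z => E z /\ z < x)) (G b - G a)) as [e [_ [H1 H2]]].
    - apply cov_interval; auto. intros z [Hz _]; auto.
    - intros m Hm; eapply cov_nonneg; exact Hm.
    - exists e; split; [exact H1|]. intros eps He. destruct (H2 eps He) as [m [Hm Hl]].
      apply cov_incl with (fun z => E z /\ z < x) m; auto; lra. }
  exists (fun x => proj1_sig (constructive_indefinite_description _ (K x))).
  intros x. exact (proj2_sig (constructive_indefinite_description _ (K x))).
Qed.

Lemma continuity_dominated (e G : R -> R) :
  continuity G -> (forall c d, c <= d -> 0 <= e d - e c <= G d - G c) -> continuity e.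
Proof.
  intros cG H. apply continuity_eps. intros x eps He.
  destruct (proj1 (continuity_eps G) cG x eps He) as [d [Hd K]].
  exists d; split; [exact Hd|]. intros y Hy. specialize (K y Hy).
  destruct (Rle_dec x y) as [L|L].
  - specialize (H x y L). split_Rabs; lra.
  - specialize (H y x ltac:(lra)). split_Rabs; lra.
Qed.

(* If [W] dominates the increments of [g = F - q G], so does [W - p e], where [e x] is the outer
   [dG]-measure of the part of the set to the left of [x]: on [[c, d]] one of [W - g], [W + g] has
   increment [W d - W c - Rabs (g d - g c)] and slope at least [2 p] with respect to [G] at every
   point of the set.  Repeating this forces [e] to be constant. *)
Lemma oscillation_null F G a b s t :
  continuity F -> continuity G -> nondecreasing F -> nondecreasing G ->
  a <= b -> 0 <= s < t ->
  null G (fun x => a < x < b /\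
    (forall del, 0 < del -> exists y,
       Rabs (y - x) < del /\ Rabs (F y - F x) < s * Rabs (G y - G x)) /\
    (forall del, 0 < del -> exists y,
       Rabs (y - x) < del /\ t * Rabs (G y - G x) < Rabs (F y - F x))).
Proof.
  intros cF cG mF mG Hab Hst.
  set (E := fun x => a < x < b /\ _).
  (* Centring at the midpoint turns slopes of [F] against [G] below [s] or above [t] into slopes of
     [g] below [- p] or above [p]. *)
  set (q := (s + t) / 2). set (p := (t - s) / 2).
  assert (Hp : 0 < p) by (unfold p; lra).
  assert (Hq : 0 <= q) by (unfold q; lra).
  set (g := fun x => F x - q * G x).
  assert (cg : continuity g).
  { apply continuity_minus; [exact cF|apply continuity_scal; exact cG]. }
  destruct (outer_measure_exists G a b E mG Hab) as [e He].
  { intros x Hx; apply Hx. }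
  assert (Hsub : forall c d m, c <= d -> cov G (fun z => E z /\ c < z < d) m -> e d - e c <= m).
  { intros c d m Hcd Hm. apply le_epsilon. intros eps Hep.
    assert (e d <= e c + eps / 2 + eps / 2 + m); [|lra].
    apply He. apply cov_incl with
      (fun z => ((E z /\ z < c) \/ z = c) \/ (E z /\ c < z < d)) (e c + eps / 2 + eps / 2 + m).
    - intros z [Hz Hzd]. destruct (Rtotal_order z c) as [L|[L|L]]; auto.
    - lra.
    - apply cov_union; [apply cov_union|exact Hm].
      + apply He; lra.
      + apply null_point; auto; lra. }
  assert (Hmono : forall c d, c <= d -> 0 <= e d - e c <= G d - G c).
  { intros c d Hcd; split.
    - assert (e c <= e d); [|lra]. apply le_epsilon. intros eps Hep. apply He.
      apply cov_incl with (fun z => E z /\ z < d) (e d + eps); [|lra|apply He; exact Hep].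
      intros z [Hz L]; split; [exact Hz|lra].
    - apply Hsub; [exact Hcd|]. apply cov_interval; auto. intros z Hz; apply Hz. }
  assert (ce : continuity e) by (apply continuity_dominated with G; auto).
  assert (Hstep : forall W, continuity W ->
    (forall c d, c <= d -> Rabs (g d - g c) <= W d - W c) ->
    forall c d, c <= d -> Rabs (g d - g c) <= (W d - p * e d) - (W c - p * e c)).
  { intros W cW HW c d Hcd.
    assert (K : e d - e c <= 2 * (W d - W c - Rabs (g d - g c)) / (2 * p)).
    { apply Hsub; [exact Hcd|].
      destruct (Rle_dec (g c) (g d)) as [Hg|Hg].
      - rewrite (Rabs_pos_eq (g d - g c)) by lra.
        replace (W d - W c - (g d - g c)) with ((W d - g d) - (W c - g c)) by lra.
        apply (rising_sun (fun x => W x - g x) G); auto; try lra.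
        + apply continuity_minus; auto.
        + intros x y Hxy. specialize (HW x y Hxy). split_Rabs; lra.
        + intros x [Hx Hxcd]. split; [exact Hxcd|].
          destruct Hx as [_ [Hx _]].
          destruct (Hx (Rmin (x - c) (d - x))) as [y [Hy1 Hy2]]; [apply Rmin_pos; lra|].
          pose proof (Rmin_l (x - c) (d - x)); pose proof (Rmin_r (x - c) (d - x)).
          assert (Hycd : c <= y <= d) by (split_Rabs; lra).
          exists y; split; [exact Hycd|].
          destruct (Rle_dec x y) as [L|L].
          * pose proof (mF x y L); pose proof (mG x y L). specialize (HW x y L).
            rewrite (Rabs_pos_eq (G y - G x)) in * by lra.
            rewrite (Rabs_pos_eq (F y - F x)) in * by lra.
            apply Rlt_le_trans with (W y - g y - (W x - g x)); [|apply Rle_abs].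
            assert (g y - g x < - p * (G y - G x)) by (unfold g, p, q; lra).
            assert (- (g y - g x) <= Rabs (g y - g x)) by (split_Rabs; lra). lra.
          * apply Rnot_le_lt, Rlt_le in L.
            pose proof (mF y x L); pose proof (mG y x L). specialize (HW y x L).
            rewrite (Rabs_minus_sym (G y)), (Rabs_pos_eq (G x - G y)) in * by lra.
            rewrite (Rabs_minus_sym (F y)), (Rabs_pos_eq (F x - F y)) in * by lra.
            rewrite Rabs_minus_sym.
            apply Rlt_le_trans with (W x - g x - (W y - g y)); [|apply Rle_abs].
            assert (g x - g y < - p * (G x - G y)) by (unfold g, p, q; lra).
            assert (- (g x - g y) <= Rabs (g x - g y)) by (split_Rabs; lra). lra.
      - rewrite (Rabs_left (g d - g c)) by lra.
        replace (W d - W c - - (g d - g c)) with ((W d + g d) - (W c + g c)) by lra.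
        apply (rising_sun (fun x => W x + g x) G); auto; try lra.
        + apply continuity_plus; auto.
        + intros x y Hxy. specialize (HW x y Hxy). split_Rabs; lra.
        + intros x [Hx Hxcd]. split; [exact Hxcd|].
          destruct Hx as [_ [_ Hx]].
          destruct (Hx (Rmin (x - c) (d - x))) as [y [Hy1 Hy2]]; [apply Rmin_pos; lra|].
          pose proof (Rmin_l (x - c) (d - x)); pose proof (Rmin_r (x - c) (d - x)).
          assert (Hycd : c <= y <= d) by (split_Rabs; lra).
          exists y; split; [exact Hycd|].
          destruct (Rle_dec x y) as [L|L].
          * pose proof (mF x y L); pose proof (mG x y L). specialize (HW x y L).
            rewrite (Rabs_pos_eq (G y - G x)) in * by lra.
            rewrite (Rabs_pos_eq (F y - F x)) in * by lra.
            apply Rlt_le_trans with (W y + g y - (W x + g x)); [|apply Rle_abs].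
            assert (p * (G y - G x) < g y - g x) by (unfold g, p, q; lra).
            pose proof (Rle_abs (g y - g x)). lra.
          * apply Rnot_le_lt, Rlt_le in L.
            pose proof (mF y x L); pose proof (mG y x L). specialize (HW y x L).
            rewrite (Rabs_minus_sym (G y)), (Rabs_pos_eq (G x - G y)) in * by lra.
            rewrite (Rabs_minus_sym (F y)), (Rabs_pos_eq (F x - F y)) in * by lra.
            rewrite Rabs_minus_sym.
            apply Rlt_le_trans with (W x + g x - (W y + g y)); [|apply Rle_abs].
            assert (p * (G x - G y) < g x - g y) by (unfold g, p, q; lra).
            pose proof (Rle_abs (g x - g y)). lra. }
    apply (Rmult_le_compat_l p) in K; [|lra].
    replace (p * (2 * (W d - W c - Rabs (g d - g c)) / (2 * p)))
      with (W d - W c - Rabs (g d - g c)) in K by (field; lra).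
    lra. }
  (* The iteration starts from [F + q * G], which dominates the increments of [F - q * G] because
     [F] and [G] are nondecreasing. *)
  assert (Hiter : forall (n : nat) c d, c <= d -> Rabs (g d - g c) <=
      (F d + q * G d - INR n * p * e d) - (F c + q * G c - INR n * p * e c)).
  { induction n as [|n IH].
    - intros c d Hcd. pose proof (mF c d Hcd); pose proof (mG c d Hcd). simpl INR.
      assert (0 <= q * (G d - G c)) by (apply Rmult_le_pos; lra).
      unfold g. split_Rabs; lra.
    - intros c d Hcd. rewrite S_INR.
      assert (cW : continuity (fun x => F x + q * G x - INR n * p * e x)).
      { apply continuity_minus; [apply continuity_plus; [exact cF|]|];
          apply continuity_scal; auto. }
      specialize (Hstep _ cW IH c d Hcd). cbv beta in Hstep. lra. }
  (* For every [n], the increment of [F + q * G] over [[a, b]] bounds [n * p * (e b - e a)]. *)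
  assert (Heab : e b <= e a).
  { apply Rnot_lt_le; intro L.
    assert (Hpe : 0 < p * (e b - e a)) by (apply Rmult_lt_0_compat; lra).
    set (T := F b + q * G b - (F a + q * G a)).
    destruct (INR_unbounded (T / (p * (e b - e a)))) as [n Hn].
    specialize (Hiter n a b Hab).
    pose proof (Rabs_pos (g b - g a)).
    apply (Rmult_lt_compat_r (p * (e b - e a))) in Hn; [|exact Hpe].
    unfold Rdiv in Hn. rewrite Rmult_assoc, Rinv_l, Rmult_1_r in Hn by lra.
    unfold T in Hn. lra. }
  assert (e a <= 0).
  { apply He. apply cov_incl with (fun z => E z /\ z < a) 0; auto; [lra|].
    exists (fun _ => 0); repeat split; try lra; [intros x y _; lra|].
    intros x [[Hx _] Hxa]; lra. }
  intros eps Hep. apply cov_incl with (fun z => E z /\ z < b) (e b + eps).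
  - intros x Hx; split; [exact Hx|apply Hx].
  - lra.
  - apply He; exact Hep.
Qed.

(* The reciprocal of the derivative of [G] at [x] exists and equals [k], with [k = 0] encoding an
   infinite derivative; the bound by [M] rules out a zero derivative. *)
Definition inverse_slope (G : R -> R) (a b x k : R) : Prop :=
  (exists M, 0 < M /\ forall y, a <= y <= b -> Rabs (y - x) <= M * Rabs (G y - G x)) /\
  forall eps, 0 < eps -> exists del, 0 < del /\ forall y, Rabs (y - x) < del ->
    (k - eps) * Rabs (G y - G x) <= Rabs (y - x) <= (k + eps) * Rabs (G y - G x).

(** Neighbouring points of the grids [j / (n + 1)] form the countable family of thresholds across
    which oscillation is tested. A mesh below half of [l - r] suffices: rounding [r] up costs at
    most one mesh, the next grid point another. *)
Lemma grid_between r l : 0 <= r -> r < l ->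
  exists n j : nat, r <= INR j / INR (S n) /\ INR (S j) / INR (S n) < l.
Proof.
  intros Hr Hl.
  destruct (INR_unbounded (2 / (l - r))) as [n Hn].
  assert (HN : 0 < INR (S n)) by (apply lt_0_INR; lia).
  assert (Hln : 2 < (l - r) * INR (S n)).
  { apply (Rmult_lt_compat_r (l - r)) in Hn; [|lra].
    unfold Rdiv in Hn. rewrite Rmult_assoc, Rinv_l, Rmult_1_r in Hn by lra.
    rewrite S_INR; nra. }
  destruct (archimed (r * INR (S n))) as [H1 H2].
  assert (Hz : (0 <= up (r * INR (S n)))%Z).
  { apply le_IZR. assert (0 <= r * INR (S n)) by (apply Rmult_le_pos; lra). lra. }
  exists n, (Z.to_nat (up (r * INR (S n)))).
  assert (Hj : INR (Z.to_nat (up (r * INR (S n)))) = IZR (up (r * INR (S n)))).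
  { rewrite INR_IZR_INZ, Z2Nat.id; auto. }
  rewrite (S_INR (Z.to_nat _)), Hj. split.
  - apply Rmult_le_reg_r with (INR (S n)); [exact HN|].
    unfold Rdiv; rewrite Rmult_assoc, Rinv_l, Rmult_1_r by lra. lra.
  - apply Rmult_lt_reg_r with (INR (S n)); [exact HN|].
    unfold Rdiv; rewrite Rmult_assoc, Rinv_l, Rmult_1_r by lra. lra.
Qed.

(** Lebesgue's theorem for the identity differentiated against [G]: if the quotient is bounded and
    oscillates across no pair of grid values, its upper limit is its limit. *)
Lemma null_no_inverse_slope G a b :
  continuity G -> nondecreasing G -> a <= b ->
  null G (fun x => a < x < b /\ ~ exists k, 0 <= k /\ inverse_slope G a b x k).
Proof.
  intros cG mG Hab.
  assert (cid : continuity (fun x => x)).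
  { intros x. apply derivable_continuous_pt, derivable_pt_id. }
  assert (mid : nondecreasing (fun x => x)) by (intros x y; auto).
  set (Binf := fun x => a < x < b /\
    forall M, 0 < M -> exists y, a <= y <= b /\ M * Rabs (G y - G x) < Rabs (y - x)).
  set (Eosc := fun (n j : nat) x => a < x < b /\
    (forall del, 0 < del -> exists y, Rabs (y - x) < del /\
       Rabs (y - x) < INR j / INR (S n) * Rabs (G y - G x)) /\
    (forall del, 0 < del -> exists y, Rabs (y - x) < del /\
       INR (S j) / INR (S n) * Rabs (G y - G x) < Rabs (y - x))).
  apply null_incl with (fun x => Binf x \/ exists n j, Eosc n j x).
  - intros x [Hx Hk]. apply NNPP; intro Hn. apply not_or_and in Hn as [HnB HnE].
    apply Hk; clear Hk.
    assert (HM : exists M, 0 < M /\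
      forall y, a <= y <= b -> Rabs (y - x) <= M * Rabs (G y - G x)).
    { apply NNPP; intro Hc. apply HnB; split; [exact Hx|]. intros M HM.
      apply NNPP; intro Hy. apply Hc. exists M; split; [exact HM|]. intros y Hyab.
      apply Rnot_lt_le; intro L. apply Hy; exists y; auto. }
    (* [Q] collects the eventual upper bounds of the quotient, so its infimum [k] is the upper
       limit, phrased without dividing by increments of [G] that may vanish. *)
    set (Q := fun r => 0 <= r /\ exists del, 0 < del /\ forall y, Rabs (y - x) < del ->
      Rabs (y - x) <= r * Rabs (G y - G x)).
    destruct HM as [M [HM0 HM]].
    destruct (infimum_exists Q M) as [k [Hk0 [Hk1 Hk2]]].
    { split; [lra|]. exists (Rmin (x - a) (b - x)); split; [apply Rmin_pos; lra|].
      intros y Hy. pose proof (Rmin_l (x - a) (b - x)). pose proof (Rmin_r (x - a) (b - x)).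
      apply HM. split_Rabs; lra. }
    { intros m Hm; apply Hm. }
    exists k; split; [exact Hk0|]. split; [exists M; auto|].
    intros eps He. destruct (Hk2 eps He) as [r [[Hr [d1 [Hd1 K1]]] Hrk]].
    assert (Hlow : exists d2, 0 < d2 /\ forall y, Rabs (y - x) < d2 ->
      (k - eps) * Rabs (G y - G x) <= Rabs (y - x)).
    { destruct (Rle_dec 0 (k - eps)) as [Hke|Hke].
      2:{ exists 1; split; [lra|]. intros y _.
          pose proof (Rabs_pos (G y - G x)); pose proof (Rabs_pos (y - x)). nra. }
      destruct (grid_between (k - eps) k) as [n [j [Hj1 Hj2]]]; [exact Hke|lra|].
      apply NNPP; intro Hc. apply HnE. exists n, j. split; [exact Hx|]. split.
      - intros del Hdel. apply NNPP; intro Hy. apply Hc. exists del; split; [exact Hdel|].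
        intros y Hyd. apply Rnot_lt_le; intro L. apply Hy. exists y; split; [exact Hyd|].
        apply Rlt_le_trans with (1 := L). apply Rmult_le_compat_r; [apply Rabs_pos|exact Hj1].
      - intros del Hdel. apply NNPP; intro Hy.
        assert (k <= INR (S j) / INR (S n)); [|lra].
        apply Hk1. split.
        + apply Rdiv_le_0_compat; [apply pos_INR|apply lt_0_INR; lia].
        + exists del; split; [exact Hdel|]. intros y Hyd. apply Rnot_lt_le; intro L.
          apply Hy; exists y; auto. }
    destruct Hlow as [d2 [Hd2 K2]].
    exists (Rmin d1 d2); split; [apply Rmin_pos; auto|]. intros y Hy.
    pose proof (Rmin_l d1 d2); pose proof (Rmin_r d1 d2). split.
    + apply K2; lra.
    + apply Rle_trans with (r * Rabs (G y - G x)); [apply K1; lra|].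
      apply Rmult_le_compat_r; [apply Rabs_pos|lra].
  - apply null_union.
    + intros eps He.
      (* The rising sun lemma covers [Binf] with mass [2 * (b - a) / M] for each [M > 0]; the added
         1 keeps this [M] positive when [a = b]. *)
      assert (HM : 0 < 2 * (b - a) / eps + 1).
      { assert (0 <= 2 * (b - a) / eps) by (apply Rdiv_le_0_compat; lra). lra. }
      apply cov_incl with Binf (2 * (b - a) / (2 * (b - a) / eps + 1)); auto.
      * apply Rmult_le_reg_r with (2 * (b - a) / eps + 1); [exact HM|].
        unfold Rdiv at 1; rewrite Rmult_assoc, Rinv_l by lra.
        apply Rle_trans with (2 * (b - a) + eps); [lra|]. right; field; lra.
      * apply (rising_sun (fun x => x) G); auto.
        intros x [Hx HB]; split; [exact Hx|]. exact (HB _ HM).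
    + apply null_countable; intros n. apply null_countable; intros j.
      apply (oscillation_null (fun x => x) G); auto.
      assert (HN : 0 < INR (S n)) by (apply lt_0_INR; lia).
      split.
      * apply Rdiv_le_0_compat; [apply pos_INR|exact HN].
      * unfold Rdiv; apply Rmult_lt_compat_r; [apply Rinv_0_lt_compat; exact HN|].
        rewrite (S_INR j); lra.
Qed.

(** * Perfect sets in the complement of a null set *)

(** An open set with at most half of the [dG]-mass contains [N], so its complement [K] in [[a, b]]
    is closed and not null. [P] is the support of [dG] restricted to [K]. *)
Lemma perfect_avoiding_null G a b (N : R -> Prop) :
  continuity G -> nondecreasing G -> a <= b -> G a < G b -> null G N ->
  exists P, perfect_set P /\ forall x, P x -> a < x < b /\ ~ N x.
Proof.
  intros cG mG Hab HGab HN.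
  (* The end points are thrown into the null set so that [P] falls into the open interval. *)
  assert (HN' : null G (fun x => N x \/ (x = a \/ x = b))).
  { repeat apply null_union; auto; apply null_point; auto. }
  destruct (HN' ((G b - G a) / 2)) as [phi [Hp1 [Hp2 Hp3]]]; [lra|].
  set (K := fun x => a <= x <= b /\ ~ dominated_near phi G x).
  set (P := fun x => forall eta, 0 < eta -> ~ null G (fun y => K y /\ Rabs (y - x) < eta)).
  assert (Hcomp : forall s t, s <= t -> (forall z, s <= z <= t -> ~ P z) ->
    null G (fun y => K y /\ s <= y <= t)).
  { intros s t Hst HP.
    apply (interval_chain (fun s t => null G (fun y => K y /\ s <= y <= t))); auto.
    - intros r1 r2 r3 H1 H2. apply null_incl with
        (fun y => (K y /\ r1 <= y <= r2) \/ (K y /\ r2 <= y <= r3)).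
      + intros y [Hy Hr]. destruct (Rle_dec y r2); [left|right]; split; auto; lra.
      + apply null_union; auto.
    - intros z Hz. apply NNPP; intro Hc. apply (HP z Hz). intros eta Heta Hnull.
      apply Hc. exists eta; split; [exact Heta|]. intros u v _ _ H1 _ H2.
      apply null_incl with (2 := Hnull). intros y [Hy Huv]; split; [exact Hy|].
      split_Rabs; lra. }
  assert (HPK : forall x, P x -> K x).
  { intros x HP. apply NNPP; intro HK.
    assert (Hout : exists eta, 0 < eta /\ forall y, Rabs (y - x) < eta -> ~ K y).
    { destruct (Rlt_dec x a) as [L|L].
      { exists (a - x); split; [lra|]. intros y Hy [HKy _]. split_Rabs; lra. }
      destruct (Rlt_dec b x) as [L'|L'].
      { exists (x - b); split; [lra|]. intros y Hy [HKy _]. split_Rabs; lra. }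
      assert (Hd : dominated_near phi G x).
      { apply NNPP; intro Hc; apply HK; split; [lra|exact Hc]. }
      destruct Hd as [d [Hd Hdom]]. exists (d / 2); split; [lra|].
      intros y Hy [_ HKy]. apply HKy. exists (d / 2); split; [lra|].
      intros u v A B C. apply Hdom; split_Rabs; lra. }
    destruct Hout as [eta [Heta Hout]]. apply (HP eta Heta), null_empty.
    intros y [HKy Hy]; exact (Hout y Hy HKy). }
  exists P; split; [repeat split|].
  - apply NNPP; intro Hc.
    (* If [P] were empty, [K] would be null. A cover [psi] of [K] with a quarter of the mass and
       [phi] with half of it would then together dominate [G] on all of [[a, b]]. *)
    destruct (Hcomp a b Hab) with (eps := (G b - G a) / 4) as [psi [Hs1 [Hs2 Hs3]]].
    { intros z _ HP; apply Hc; exists z; exact HP. }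
    { lra. }
    assert (G b - G a <= (phi b + psi b) - (phi a + psi a)).
    { apply (interval_chain (fun u v => G v - G u <= (phi v + psi v) - (phi u + psi u)));
        auto.
      - intros; lra.
      - intros t Ht. destruct (classic (dominated_near phi G t)) as [Hd|Hd].
        + destruct (dominated_near_add phi psi G t Hs1 Hd) as [d [Hd0 Hd1]].
          exists d; split; [exact Hd0|]. intros u v _ _ A B C; apply Hd1; auto.
        + destruct (dominated_near_add psi phi G t Hp1 (Hs3 t (conj (conj Ht Hd) Ht)))
            as [d [Hd0 Hd1]].
          exists d; split; [exact Hd0|]. intros u v _ _ A B C.
          specialize (Hd1 u v A B C). lra. }
    pose proof (Hp2 a); pose proof (Hp2 b); pose proof (Hs2 a); pose proof (Hs2 b). lra.
  - intros x Hx eta Heta Hnull. destruct (Hx (eta / 2)) as [p [Hp Hpx]]; [lra|].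
    apply (Hp (eta / 2)); [lra|]. apply null_incl with (2 := Hnull).
    intros y [HKy Hy]; split; [exact HKy|]. split_Rabs; lra.
  - intros x Hx eps He. apply NNPP; intro Hc.
    assert (Hiso : forall z, z <> x -> Rabs (z - x) < eps -> ~ P z).
    { intros z Hz1 Hz2 HP. apply Hc; exists z; auto. }
    apply (Hx (eps / 2)); [lra|].
    (* If [x] were isolated in [P], then near [x] the set [K] would lie in the point [x] and
       countably many segments free of [P], each meeting [K] in a null set. *)
    set (r := fun n : nat => eps / 2 / (INR n + 1)).
    assert (Hr : forall n, 0 < r n <= eps / 2).
    { intros n. pose proof (pos_INR n). unfold r. split.
      - apply Rdiv_lt_0_compat; lra.
      - apply Rmult_le_reg_r with (INR n + 1); [lra|].
        unfold Rdiv at 1; rewrite Rmult_assoc, Rinv_l by lra. nra. }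
    apply null_incl with (fun y => y = x \/ exists n : nat,
      (K y /\ x - eps / 2 <= y <= x - r n) \/ (K y /\ x + r n <= y <= x + eps / 2)).
    + intros y [HKy Hy]. destruct (Req_dec y x) as [Heq|Hne]; [left; exact Heq|right].
      assert (Hpos : 0 < Rabs (y - x)) by (apply Rabs_pos_lt; lra).
      destruct (INR_unbounded (eps / 2 / Rabs (y - x))) as [n Hn].
      assert (Hrn : r n <= Rabs (y - x)).
      { apply (Rmult_lt_compat_r (Rabs (y - x))) in Hn; [|exact Hpos].
        unfold Rdiv in Hn at 1. rewrite Rmult_assoc, Rinv_l, Rmult_1_r in Hn by lra.
        pose proof (pos_INR n). unfold r. apply Rmult_le_reg_r with (INR n + 1); [lra|].
        unfold Rdiv at 1; rewrite Rmult_assoc, Rinv_l by lra. nra. }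
      exists n. destruct (Rle_dec y x); [left|right]; split; auto; split_Rabs; lra.
    + apply null_union; [apply null_point; auto|].
      apply null_countable; intros n. specialize (Hr n). apply null_union; apply Hcomp; try lra.
      * intros z Hz. apply Hiso; [lra|split_Rabs; lra].
      * intros z Hz. apply Hiso; [lra|split_Rabs; lra].
  - intros x HP. apply HPK in HP as [Hxab Hnd].
    assert (x <> a) by (intros ->; apply Hnd, Hp3; auto).
    assert (x <> b) by (intros ->; apply Hnd, Hp3; auto).
    split; [lra|]. intro HNx; apply Hnd, Hp3; auto.
Qed.

(** * Differentiability of functions with the chord condition *)

Lemma last_crossing (f : R -> R) z y tau :
  continuity f -> z <= y -> f z <= tau -> tau < f y ->
  exists u, z <= u < y /\ f u = tau /\ forall w, u <= w <= y -> tau <= f w.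
Proof.
  intros cf Hzy Hz Hy. rewrite continuity_eps in cf.
  destruct (completeness (fun w => z <= w <= y /\ f w <= tau)) as [u [Hub Hlub]].
  { exists y; intros w [Hw _]; lra. }
  { exists z; split; [lra|exact Hz]. }
  assert (Hzu : z <= u) by (apply Hub; split; [lra|exact Hz]).
  assert (Huy : u <= y) by (apply Hlub; intros w [Hw _]; lra).
  assert (Hright : forall w, u < w <= y -> tau < f w).
  { intros w Hw. apply Rnot_le_lt; intro L.
    assert (w <= u); [|lra]. apply Hub; split; [lra|exact L]. }
  assert (Hle : f u <= tau).
  { apply Rnot_lt_le; intro L.
    destruct (cf u (f u - tau)) as [d [Hd K]]; [lra|].
    assert (u <= u - d); [|lra]. apply Hlub. intros w [Hw Hfw].
    apply Rnot_lt_le; intro L'.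
    assert (w <= u) by (apply Hub; split; auto).
    assert (A : Rabs (w - u) < d) by (split_Rabs; lra).
    specialize (K w A). split_Rabs; lra. }
  assert (Huy' : u < y).
  { destruct (Req_dec u y) as [->|]; lra. }
  assert (Hge : tau <= f u).
  { apply Rnot_lt_le; intro L.
    destruct (cf u (tau - f u)) as [d [Hd K]]; [lra|].
    set (w := Rmin y (u + d / 2)).
    assert (Hw : u < w <= y /\ w <= u + d / 2) by (unfold w, Rmin; destruct Rle_dec; lra).
    assert (A : Rabs (w - u) < d) by (split_Rabs; lra).
    specialize (K w A). destruct Hw as [Hw _]. specialize (Hright w Hw). split_Rabs; lra. }
  exists u; split; [lra|]. split; [lra|]. intros w Hw.
  destruct (Req_dec w u) as [->|]; [exact Hge|]. left; apply Hright; lra.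
Qed.

(** Clamping removes the arbitrary values beyond [b] and makes [G] continuous and nondecreasing on
    the whole line, as the covering lemmas require. *)
Lemma running_min_continuous (f : R -> R) a b :
  continuity f -> a <= b ->
  exists G : R -> R, continuity G /\ nondecreasing G /\
    forall x, a <= x <= b ->
      (forall y, x <= y <= b -> G x <= f y) /\ (exists z, x <= z <= b /\ f z = G x).
Proof.
  intros cf Hab.
  destruct (running_max (fun x => - f x) b) as [H HH]; [apply continuity_opp; exact cf|].
  assert (Hdec : forall x y, x <= y <= b -> H y <= H x).
  { intros x y Hxy. destruct (HH y) as [_ [z [Hz <-]]]; [lra|]. apply HH; lra. }
  set (G0 := fun x => - H x).
  assert (cG0 : forall x eps, x <= b -> 0 < eps -> exists del, 0 < del /\
    forall y, y <= b -> Rabs (y - x) < del -> Rabs (G0 y - G0 x) < eps).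
  { intros x eps Hx He.
    destruct (proj1 (continuity_eps f) cf x (eps / 3)) as [d [Hd K]]; [lra|].
    exists d; split; [exact Hd|].
    assert (Hinc : forall p q, p <= q <= b -> Rabs (p - x) < d -> Rabs (q - x) < d ->
      H p < H q + eps).
    { intros p q Hpq Hp Hq. destruct (HH p) as [_ [z [Hz <-]]]; [lra|].
      destruct (HH q) as [Hq1 _]; [lra|].
      destruct (Rle_dec q z) as [L|L].
      - specialize (Hq1 z). lra.
      - specialize (Hq1 q). assert (A : Rabs (z - x) < d) by (split_Rabs; lra).
        pose proof (K z A). pose proof (K q Hq). split_Rabs; lra. }
    intros y Hy Hyx. assert (A : Rabs (x - x) < d) by (rewrite Rminus_diag, Rabs_R0; exact Hd).
    unfold G0. destruct (Rle_dec x y) as [L|L].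
    - specialize (Hdec x y). specialize (Hinc x y). split_Rabs; lra.
    - specialize (Hdec y x). specialize (Hinc y x). split_Rabs; lra. }
  exists (fun x => G0 (clamp a b x)). repeat split.
  - apply continuity_eps. intros x eps He.
    pose proof (clamp_in a b x Hab).
    destruct (cG0 (clamp a b x) eps) as [d [Hd K]]; [lra|exact He|].
    exists d; split; [exact Hd|]. intros y Hy. apply K.
    + apply clamp_in; exact Hab.
    + apply Rle_lt_trans with (2 := Hy), clamp_lipschitz.
  - intros x y Hxy. unfold G0. apply Ropp_le_contravar, Hdec.
    split; [apply clamp_le; exact Hxy|apply clamp_in; exact Hab].
  - intros y Hy. rewrite clamp_id by lra. destruct (HH x) as [Hx _]; [lra|].
    specialize (Hx y Hy). unfold G0. lra.
  - rewrite clamp_id by lra. destruct (HH x) as [_ [z [Hz Hzx]]]; [lra|].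
    exists z; split; [exact Hz|]. unfold G0. lra.
Qed.

(* On a gap [(u, v)] of the contact set of [f] and [G], [G] is constant, so [v - u] is small
   compared with [G y - G x]; the chord condition then makes [f y - G y] equally small. *)
Lemma running_min_first_order (f G : R -> R) a b c x k :
  continuity f -> continuity G -> nondecreasing G -> 0 <= c ->
  (forall x, a <= x <= b ->
      (forall y, x <= y <= b -> G x <= f y) /\ (exists z, x <= z <= b /\ f z = G x)) ->
  (forall u y v, a <= u -> u < y -> y < v -> v <= b -> f u = f v ->
      Rabs (f y - f u) <= c * (v - u)) ->
  a < x < b -> inverse_slope G a b x k ->
  forall eta, 0 < eta -> exists del, 0 < del /\ forall y, y <> x -> Rabs (y - x) < del ->
    0 < Rabs (G y - G x) /\
    Rabs (f y - f x - (G y - G x)) <= eta * Rabs (G y - G x) /\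
    (k - eta) * Rabs (G y - G x) <= Rabs (y - x) <= (k + eta) * Rabs (G y - G x).
Proof.
  intros cf cG mG Hc HG Hchord Hx [[M [HM0 HM]] Hlim] eta Heta.
  assert (Hinj : forall y, a <= y <= b -> G y = G x -> y = x).
  { intros y Hy Heq. specialize (HM y Hy). rewrite Heq, Rminus_diag, Rabs_R0 in HM.
    split_Rabs; lra. }
  assert (HfG : forall y, a <= y <= b -> G y <= f y) by (intros y Hy; apply HG; lra).
  (* A minimiser [z] of [f] on [[x, b]] satisfies [G z <= f z = G x], hence [G z = G x], and [Hinj]
     gives [z = x]. *)
  assert (Hfx : f x = G x).
  { destruct (HG x) as [_ [z [Hz Hfz]]]; [lra|].
    assert (z = x); [|congruence]. apply Hinj; [lra|].
    pose proof (mG x z (proj1 Hz)). pose proof (HfG z ltac:(lra)). lra. }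
  assert (HGa : G a < G x).
  { pose proof (mG a x ltac:(lra)). destruct (Req_dec (G a) (G x)) as [Heq|]; [|lra].
    apply Hinj in Heq; lra. }
  (* Both [2 * c * eps <= eta], for the chord, and [eps <= eta], for the slope, are wanted. *)
  set (eps := eta / (2 * c + 1)).
  assert (Heps : 0 < eps) by (unfold eps; apply Rdiv_lt_0_compat; lra).
  assert (Heps2 : eps * (2 * c + 1) = eta) by (unfold eps; field; lra).
  destruct (Hlim eps Heps) as [d1 [Hd1 K1]].
  (* The tolerance [d1 / M] brings the ends of the gap around [y] within [d1] of [x]; the tolerance
     [G x - G a] gives [G a < G y], so [f] takes a value at most [G y] to the left of [y]. *)
  destruct (proj1 (continuity_eps G) cG x (Rmin (d1 / M) (G x - G a))) as [d2 [Hd2 K2]].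
  { apply Rmin_pos; [apply Rdiv_lt_0_compat; auto|lra]. }
  exists (Rmin (Rmin d1 d2) (Rmin (x - a) (b - x))).
  split; [repeat apply Rmin_pos; lra|]. intros y Hyx Hy.
  pose proof (Rmin_l (Rmin d1 d2) (Rmin (x - a) (b - x))).
  pose proof (Rmin_r (Rmin d1 d2) (Rmin (x - a) (b - x))).
  pose proof (Rmin_l d1 d2). pose proof (Rmin_r d1 d2).
  pose proof (Rmin_l (x - a) (b - x)). pose proof (Rmin_r (x - a) (b - x)).
  assert (Hyab : a < y < b) by (split_Rabs; lra).
  specialize (K2 y ltac:(lra)).
  pose proof (Rmin_l (d1 / M) (G x - G a)). pose proof (Rmin_r (d1 / M) (G x - G a)).
  assert (HD : 0 < Rabs (G y - G x)).
  { apply Rabs_pos_lt. intro Heq. apply Hyx, Hinj; lra. }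
  set (D := Rabs (G y - G x)) in *.
  assert (HMD : M * D < d1).
  { apply Rlt_le_trans with (M * (d1 / M)); [apply Rmult_lt_compat_l; lra|].
    right; field; lra. }
  split; [exact HD|]. split.
  - rewrite Hfx. replace (f y - G x - (G y - G x)) with (f y - G y) by lra.
    destruct (Req_dec (f y) (G y)) as [Heq|Hne].
    { rewrite Heq, Rminus_diag, Rabs_R0. nra. }
    pose proof (HfG y ltac:(lra)) as Hfy.
    destruct (HG y) as [HGy [v [Hv Hfv]]]; [lra|].
    assert (Hvy : y < v) by (destruct (Req_dec v y) as [->|]; lra).
    assert (HGv : G v = G y).
    { pose proof (mG y v ltac:(lra)). pose proof (HfG v ltac:(lra)). lra. }
    assert (Hz : exists z, a <= z <= y /\ f z <= G y).
    { destruct (HG a) as [_ [z [Hz Hfz]]]; [lra|].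
      assert (HGay : G a < G y) by (unfold D in K2; split_Rabs; lra).
      exists z; split; [|lra]. split; [lra|].
      apply Rnot_lt_le; intro L. specialize (HGy z). lra. }
    destruct Hz as [z [Hz Hfz]].
    destruct (last_crossing f z y (G y)) as [u [Hu [Hfu Hw]]]; auto; try lra.
    assert (HGu : G u = G y).
    { pose proof (mG u y ltac:(lra)). destruct (HG u) as [_ [w [Hw1 Hw2]]]; [lra|].
      destruct (Rle_dec y w) as [L|L].
      - specialize (HGy w). lra.
      - specialize (Hw w). lra. }
    pose proof (HM u ltac:(lra)) as Hux. pose proof (HM v ltac:(lra)) as Hvx.
    rewrite HGu in Hux. rewrite HGv in Hvx. fold D in Hux, Hvx.
    pose proof (K1 u ltac:(lra)) as K1u. pose proof (K1 v ltac:(lra)) as K1v.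
    rewrite HGu in K1u. rewrite HGv in K1v. fold D in K1u, K1v.
    (* Both ends carry the value [G y <> G x], so they lie on one side of [x], at distances within
       [eps * D] of [k * D]. *)
    assert (Hside : x < u \/ v < x).
    { apply NNPP; intro Hn. apply Hyx, Hinj; [lra|].
      pose proof (mG u x ltac:(lra)). pose proof (mG x v ltac:(lra)). lra. }
    assert (Hvu : v - u <= 2 * eps * D) by (split_Rabs; lra).
    rewrite <- Hfu at 1. apply Rle_trans with (c * (v - u)); [apply Hchord; lra|].
    apply Rle_trans with (c * (2 * eps * D)); [apply Rmult_le_compat_l; lra|].
    rewrite <- Heps2. nra.
  - pose proof (K1 y ltac:(lra)) as K1y. fold D in K1y.
    assert (eps <= eta) by nra. nra.
Qed.

(** The limit is [1 / k], or plus infinity for [k = 0]; the sign comes from the monotonicity of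
    [G]. *)
Lemma is_lim_quotient_of_first_order (f G : R -> R) x k :
  nondecreasing G -> 0 <= k ->
  (forall eta, 0 < eta -> exists del, 0 < del /\ forall y, y <> x -> Rabs (y - x) < del ->
    0 < Rabs (G y - G x) /\
    Rabs (f y - f x - (G y - G x)) <= eta * Rabs (G y - G x) /\
    (k - eta) * Rabs (G y - G x) <= Rabs (y - x) <= (k + eta) * Rabs (G y - G x)) ->
  exists l : Rbar, is_lim (fun y => (f y - f x) / (y - x)) x l.
Proof.
  intros mG Hk H.
  assert (Habs : forall eta, 0 < eta -> exists del, 0 < del /\
    forall y, y <> x -> Rabs (y - x) < del -> exists D N X, 0 < D /\ 0 < X /\
      (f y - f x) / (y - x) = N / X /\ (1 - eta) * D <= N <= (1 + eta) * D /\
      (k - eta) * D <= X <= (k + eta) * D).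
  { intros eta Heta. destruct (H eta Heta) as [d [Hd K]]. exists d; split; [exact Hd|].
    intros y Hyx Hy. destruct (K y Hyx Hy) as [K1 [K2 K3]].
    destruct (Rle_dec x y) as [L|L].
    - pose proof (mG x y L). rewrite (Rabs_pos_eq (G y - G x)) in * by lra.
      rewrite (Rabs_pos_eq (y - x)) in * by lra.
      exists (G y - G x), (f y - f x), (y - x). repeat split; try lra; split_Rabs; lra.
    - pose proof (mG y x ltac:(lra)). rewrite (Rabs_minus_sym (G y)) in *.
      rewrite (Rabs_pos_eq (G x - G y)) in * by lra.
      rewrite (Rabs_minus_sym y), (Rabs_pos_eq (x - y)) in * by lra.
      exists (G x - G y), (f x - f y), (x - y).
      repeat split; try lra; [field; lra|split_Rabs; lra|split_Rabs; lra]. }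
  destruct (Req_dec k 0) as [->|Hk0].
  - exists p_infty. apply is_lim_spec. intros M.
    set (eta := / (2 * (Rabs M + 1))).
    pose proof (Rabs_pos M). pose proof (Rle_abs M).
    assert (Heta : 0 < eta) by (apply Rinv_0_lt_compat; lra).
    assert (He : eta * (2 * (Rabs M + 1)) = 1) by (apply Rinv_l; lra).
    destruct (Habs eta Heta) as [d [Hd K]].
    exists (mkposreal d Hd). intros y Hy Hyx.
    destruct (K y Hyx Hy) as [D [N [X [HD [HX [-> [HN HX']]]]]]].
    apply Rmult_lt_reg_r with X; [exact HX|].
    unfold Rdiv; rewrite Rmult_assoc, Rinv_l, Rmult_1_r by lra.
    assert (M * X <= Rabs M * X) by (apply Rmult_le_compat_r; lra).
    assert (Rabs M * X <= Rabs M * (eta * D)) by (apply Rmult_le_compat_l; lra).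
    assert (0 < eta * D) by (apply Rmult_lt_0_compat; lra).
    assert (HD2 : D = 2 * (eta * D) * Rabs M + 2 * (eta * D)).
    { transitivity ((eta * (2 * (Rabs M + 1))) * D); [rewrite He; ring|ring]. }
    assert (0 <= eta * D * Rabs M) by (apply Rmult_le_pos; lra).
    lra.
  - exists (Finite (/ k)). apply is_lim_spec. intros eps. simpl.
    assert (Hkp : 0 < k) by lra. pose proof (cond_pos eps) as He.
    (* The first bound gives [X >= k / 2 * D]; the second keeps the error [eta * (k + 1) * D] of
       [k * N - X] within half of [eps * (k * X)]. *)
    set (eta := Rmin (k / 2) (eps * (k * k) / (4 * (k + 1)))).
    assert (H0 : 0 < eps * (k * k) / (4 * (k + 1))).
    { apply Rdiv_lt_0_compat; [|lra]. apply Rmult_lt_0_compat; nra. }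
    assert (Heta : 0 < eta) by (apply Rmin_pos; lra).
    assert (He1 : eta <= k / 2) by apply Rmin_l.
    assert (He2 : eta * (4 * (k + 1)) <= eps * (k * k)).
    { apply Rle_trans with (eps * (k * k) / (4 * (k + 1)) * (4 * (k + 1))).
      - apply Rmult_le_compat_r; [lra|apply Rmin_r].
      - right; field; lra. }
    destruct (Habs eta Heta) as [d [Hd K]].
    exists (mkposreal d Hd). intros y Hy Hyx.
    destruct (K y Hyx Hy) as [D [N [X [HD [HX [-> [HN HX']]]]]]].
    replace (N / X - / k) with ((k * N - X) / (k * X)) by (field; lra).
    assert (HkX : 0 < k * X) by (apply Rmult_lt_0_compat; lra).
    unfold Rdiv; rewrite Rabs_mult, (Rabs_pos_eq (/ (k * X)))
      by (left; apply Rinv_0_lt_compat; exact HkX).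
    apply Rmult_lt_reg_r with (k * X); [exact HkX|].
    rewrite Rmult_assoc, Rinv_l, Rmult_1_r by lra.
    assert (A1 : Rabs (k * N - X) <= eta * (k + 1) * D).
    { apply Rabs_le. split; nra. }
    assert (A2 : k / 2 * D <= X).
    { apply Rle_trans with ((k - eta) * D); [apply Rmult_le_compat_r; lra|lra]. }
    assert (A3 : eps * (k * (k / 2 * D)) <= eps * (k * X)).
    { apply Rmult_le_compat_l; [lra|]. apply Rmult_le_compat_l; lra. }
    assert (A4 : eta * (4 * (k + 1)) * D <= eps * (k * k) * D)
      by (apply Rmult_le_compat_r; lra).
    assert (0 < eta * (k + 1) * D).
    { repeat apply Rmult_lt_0_compat; lra. }
    lra.
Qed.

Lemma perfect_differentiability_increase (f : R -> R) a b c :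
  continuity f -> a < b -> f a < f b -> 0 <= c ->
  (forall u y v, a <= u -> u < y -> y < v -> v <= b -> f u = f v ->
      Rabs (f y - f u) <= c * (v - u)) ->
  exists P, perfect_set P /\ forall x, P x -> a < x < b /\
    exists l : Rbar, is_lim (fun y => (f y - f x) / (y - x)) x l.
Proof.
  intros cf Hab Hf Hc Hchord.
  destruct (running_min_continuous f a b cf) as [G [cG [mG HG]]]; [lra|].
  assert (HGab : G a < G b).
  { pose proof (proj1 (HG a ltac:(lra)) a ltac:(lra)).
    destruct (HG b) as [_ [z [Hz Hfz]]]; [lra|]. assert (z = b) by lra. subst z. lra. }
  destruct (perfect_avoiding_null G a b _ cG mG ltac:(lra) HGab
    (null_no_inverse_slope G a b cG mG ltac:(lra))) as [P [HP1 HP2]].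
  exists P; split; [exact HP1|]. intros x HPx. destruct (HP2 x HPx) as [Hx Hk].
  split; [exact Hx|].
  assert (Hk' : exists k, 0 <= k /\ inverse_slope G a b x k).
  { apply NNPP; intro Hn; apply Hk; auto. }
  destruct Hk' as [k [Hk0 Hk1]].
  apply is_lim_quotient_of_first_order with G k; auto.
  apply running_min_first_order with a b c; auto.
Qed.

Lemma perfect_segment a b : a < b -> perfect_set (fun x => a <= x <= b).
Proof.
  intros Hab. repeat split.
  - exists a; lra.
  - apply Rnot_lt_le; intro L. destruct (H (a - x)) as [p [Hp Hpx]]; [lra|].
    split_Rabs; lra.
  - apply Rnot_lt_le; intro L. destruct (H (x - b)) as [p [Hp Hpx]]; [lra|].
    split_Rabs; lra.
  - intros p Hp eps He.
    assert (Hm : 0 < Rmin eps (b - a)) by (apply Rmin_pos; lra).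
    pose proof (Rmin_l eps (b - a)). pose proof (Rmin_r eps (b - a)).
    destruct (Rle_dec p ((a + b) / 2)).
    + exists (p + Rmin eps (b - a) / 2). split; [lra|]. split; [lra|]. split_Rabs; lra.
    + exists (p - Rmin eps (b - a) / 2). split; [lra|]. split; [lra|]. split_Rabs; lra.
Qed.

Lemma perfect_differentiability (f : R -> R) a b c :
  continuity f -> a < b -> 0 <= c ->
  (forall u y v, a <= u -> u < y -> y < v -> v <= b -> f u = f v ->
      Rabs (f y - f u) <= c * (v - u)) ->
  exists P, perfect_set P /\ forall x, P x -> a < x < b /\
    exists l : Rbar, is_lim (fun y => (f y - f x) / (y - x)) x l.
Proof.
  intros cf Hab Hc Hchord.
  destruct (classic (exists s t, a <= s /\ s < t /\ t <= b /\ f s <> f t))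
    as [[s [t [Hs [Hst [Ht Hne]]]]]|Hconst].
  - destruct (Rlt_dec (f s) (f t)) as [L|L].
    + destruct (perfect_differentiability_increase f s t c) as [P [HP1 HP2]]; auto.
      { intros u y v H1 H2 H3 H4. apply Hchord; lra. }
      exists P; split; [exact HP1|]. intros x Hx. destruct (HP2 x Hx) as [H1 H2].
      split; [lra|exact H2].
    + destruct (perfect_differentiability_increase (fun x => - f x) s t c) as [P [HP1 HP2]];
        auto; try lra.
      { apply continuity_opp; exact cf. }
      { intros u y v H1 H2 H3 H4 Heq. replace (- f y - - f u) with (- (f y - f u)) by lra.
        rewrite Rabs_Ropp. apply Hchord; lra. }
      exists P; split; [exact HP1|]. intros x Hx. destruct (HP2 x Hx) as [H1 [l H2]].
      split; [lra|]. exists (Rbar_opp l). apply is_lim_opp in H2.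
      apply is_lim_ext with (2 := H2). intros y. unfold Rdiv. ring.
  (* In the middle third, neighbourhoods of radius [(b - a) / 3] stay in [[a, b]], where [f] is
     constant. *)
  - exists (fun x => a + (b - a) / 3 <= x <= b - (b - a) / 3).
    split; [apply perfect_segment; lra|]. intros x Hx. split; [lra|].
    exists (Finite 0). apply is_lim_spec. intros eps. simpl.
    assert (Hd : 0 < (b - a) / 3) by lra.
    exists (mkposreal _ Hd). intros y Hy Hyx.
    assert (Hy' : Rabs (y - x) < (b - a) / 3) by exact Hy.
    assert (Heq : f y = f x).
    { apply NNPP; intro Hn. apply Hconst.
      destruct (Rle_dec x y); [exists x, y|exists y, x]; split_Rabs; repeat split; lra || auto. }
    rewrite Heq. replace ((f x - f x) / (y - x) - 0) with 0 by (unfold Rdiv; ring).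
    rewrite Rabs_R0. apply cond_pos.
Qed.

(** * Monotone graphs *)

Lemma dist2_euc p q : dist2 p q = dist_euc (fst p) (snd p) (fst q) (snd q).
Proof. unfold dist2, dist_euc, Rsqr. f_equal. ring. Qed.

Lemma dist2_sym p q : dist2 p q = dist2 q p.
Proof. rewrite !dist2_euc. apply distance_symm. Qed.

Lemma dist2_triangle p q r : dist2 p r <= dist2 p q + dist2 q r.
Proof. rewrite !dist2_euc. apply triangle. Qed.

Lemma dist2_coord_le p q : Rabs (fst p - fst q) <= dist2 p q /\ Rabs (snd p - snd q) <= dist2 p q.
Proof.
  pose proof (pow2_ge_0 (fst p - fst q)). pose proof (pow2_ge_0 (snd p - snd q)).
  unfold dist2. split; rewrite <- sqrt_Rsqr_abs; apply sqrt_le_1_alt; unfold Rsqr; lra.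
Qed.

Lemma dist2_le_sum p q : dist2 p q <= Rabs (fst p - fst q) + Rabs (snd p - snd q).
Proof.
  pose proof (Rabs_pos (fst p - fst q)). pose proof (Rabs_pos (snd p - snd q)).
  unfold dist2. rewrite <- (sqrt_Rsqr (Rabs (fst p - fst q) + Rabs (snd p - snd q))) by lra.
  apply sqrt_le_1_alt. unfold Rsqr.
  rewrite <- (pow2_abs (fst p - fst q)), <- (pow2_abs (snd p - snd q)). nra.
Qed.

Lemma graph_point_continuous (f : R -> R) :
  continuity f -> forall x eps, 0 < eps -> exists del, 0 < del /\
    forall y, Rabs (y - x) < del -> dist2 (y, f y) (x, f x) < eps.
Proof.
  intros cf x eps He.
  destruct (proj1 (continuity_eps f) cf x (eps / 2)) as [d [Hd K]]; [lra|].
  exists (Rmin d (eps / 2)); split; [apply Rmin_pos; lra|]. intros y Hy.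
  pose proof (Rmin_l d (eps / 2)). pose proof (Rmin_r d (eps / 2)).
  specialize (K y ltac:(lra)).
  apply Rle_lt_trans with (1 := dist2_le_sum _ _). simpl. lra.
Qed.

(** Otherwise nested segments, the [n]-th step avoiding [B n], would have a common point lying in no
    [B n]. The sets are arbitrary, so only density on a segment can result. *)
Lemma baire_interval (B : nat -> R -> Prop) a b :
  a < b -> (forall x, a < x < b -> exists n, B n x) ->
  exists n s t, a < s /\ s < t /\ t < b /\
    forall u v, s <= u -> u < v -> v <= t -> exists z, u < z < v /\ B n z.
Proof.
  intros Hab HB. apply NNPP; intro Hn.
  assert (Hstep : forall (n : nat) (J : R * R), exists J' : R * R,
    a < fst J -> fst J < snd J -> snd J < b ->
    fst J < fst J' /\ fst J' < snd J' /\ snd J' < snd J /\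
    forall z, fst J' <= z <= snd J' -> ~ B n z).
  { intros n [s t]. simpl.
    destruct (classic (a < s /\ s < t /\ t < b)) as [Hst|Hst].
    2:{ exists (0, 0); intros; exfalso; apply Hst; auto. }
    apply NNPP; intro Hc. apply Hn. exists n, s, t. repeat split; try lra.
    intros u v Hu Huv Hv. apply NNPP; intro Hz. apply Hc.
    exists (u + (v - u) / 3, v - (v - u) / 3). simpl. intros _ _ _.
    split; [lra|]. split; [lra|]. split; [lra|].
    intros z Hzuv HBz. apply Hz. exists z; split; [lra|exact HBz]. }
  set (step := fun n J => proj1_sig (constructive_indefinite_description _ (Hstep n J))).
  assert (Hs : forall n J, a < fst J -> fst J < snd J -> snd J < b ->
    fst J < fst (step n J) /\ fst (step n J) < snd (step n J) /\ snd (step n J) < snd J /\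
    forall z, fst (step n J) <= z <= snd (step n J) -> ~ B n z).
  { intros n J. exact (proj2_sig (constructive_indefinite_description _ (Hstep n J))). }
  clearbody step.
  set (J := nat_rect (fun _ => (R * R)%type) (a + (b - a) / 3, b - (b - a) / 3) step).
  assert (HJ : forall n, a < fst (J n) /\ fst (J n) < snd (J n) /\ snd (J n) < b).
  { induction n as [|n IH]; [simpl; lra|].
    change (J (S n)) with (step n (J n)). specialize (Hs n (J n)). lra. }
  assert (HJS : forall n, fst (J n) < fst (J (S n)) /\ snd (J (S n)) < snd (J n) /\
    forall z, fst (J (S n)) <= z <= snd (J (S n)) -> ~ B n z).
  { intros n. change (J (S n)) with (step n (J n)). destruct (HJ n) as [H1 [H2 H3]].
    destruct (Hs n (J n) H1 H2 H3) as [K1 [K2 [K3 K4]]]. auto. }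
  assert (Hmon : forall m n, fst (J n) <= fst (J (n + m)%nat) /\ snd (J (n + m)%nat) <= snd (J n)).
  { induction m as [|m IH]; intros n.
    - rewrite Nat.add_0_r; lra.
    - rewrite Nat.add_succ_r. specialize (IH n). specialize (HJS (n + m)%nat). lra. }
  assert (Hcross : forall m n, fst (J m) <= snd (J n)).
  { intros m n. destruct (Nat.le_ge_cases m n) as [L|L].
    - replace n with (m + (n - m))%nat by lia.
      pose proof (Hmon (n - m)%nat m). pose proof (HJ (m + (n - m))%nat). lra.
    - replace m with (n + (m - n))%nat by lia.
      pose proof (Hmon (m - n)%nat n). pose proof (HJ (n + (m - n))%nat). lra. }
  destruct (completeness (fun z => exists n, z = fst (J n))) as [x [Hub Hlub]].
  { exists b. intros z [n ->]. specialize (HJ n); lra. }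
  { exists (fst (J 0%nat)), 0%nat; reflexivity. }
  assert (HxJ : forall n, fst (J n) <= x <= snd (J n)).
  { intros n; split; [apply Hub; exists n; reflexivity|].
    apply Hlub. intros z [m ->]. apply Hcross. }
  destruct (HB x) as [n HBx].
  { specialize (HxJ 0%nat). specialize (HJ 0%nat). lra. }
  apply (proj2 (proj2 (HJS n)) x (HxJ (S n)) HBx).
Qed.

Lemma dense_near (D : R -> Prop) a b :
  a < b -> (forall u v, a <= u -> u < v -> v <= b -> exists z, u < z < v /\ D z) ->
  forall x eta, a <= x <= b -> 0 < eta -> exists z, a <= z <= b /\ D z /\ Rabs (z - x) < eta.
Proof.
  intros Hab HD x eta Hx He.
  destruct (HD (Rmax a (x - eta / 2)) (Rmin b (x + eta / 2))) as [z [Hz HDz]].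
  - apply Rmax_l.
  - unfold Rmax, Rmin; repeat destruct Rle_dec; lra.
  - apply Rmin_l.
  - exists z.
    pose proof (Rmax_l a (x - eta / 2)). pose proof (Rmax_r a (x - eta / 2)).
    pose proof (Rmin_l b (x + eta / 2)). pose proof (Rmin_r b (x + eta / 2)).
    split; [lra|]. split; [exact HDz|]. split_Rabs; lra.
Qed.

(** If the point over [u] lay between those over [z'] and [z], monotonicity would bound its distance
    from the former by [c] times their mutual distance, which is too small near [x <> u]. *)
Lemma order_side_locally_constant (f : R -> R) A lt c u x :
  continuity f -> strict_linear_order_on A lt -> 0 < c ->
  (forall p q r, A p -> A q -> A r -> lt p q -> lt q r -> dist2 p q <= c * dist2 p r) ->
  A (u, f u) -> x <> u ->
  exists del, 0 < del /\ forall z z', A (z, f z) -> A (z', f z') ->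
    Rabs (z - x) < del -> Rabs (z' - x) < del ->
    lt (u, f u) (z, f z) -> lt (u, f u) (z', f z').
Proof.
  intros cf [Hirr [Htr Htot]] Hc Hmon HAu Hxu.
  assert (Hr : 0 < Rabs (x - u)) by (apply Rabs_pos_lt; lra).
  (* Graph points within [rho] of the one over [x] are less than [2 * rho] apart and more than
     [2 * c * rho] from the one over [u]. *)
  set (rho := Rabs (x - u) / (2 * c + 1)).
  assert (Hrho : 0 < rho) by (apply Rdiv_lt_0_compat; lra).
  assert (Hrho2 : rho * (2 * c + 1) = Rabs (x - u)) by (unfold rho; field; lra).
  destruct (graph_point_continuous f cf x rho Hrho) as [d [Hd K]].
  exists d; split; [exact Hd|]. intros z z' HAz HAz' Hz Hz' Hlt.
  apply K in Hz. apply K in Hz'. apply NNPP; intro Hn.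
  pose proof (proj1 (dist2_coord_le (x, f x) (u, f u))) as Hxd; simpl in Hxd.
  pose proof (dist2_triangle (x, f x) (z', f z') (u, f u)) as T1.
  pose proof (dist2_triangle (z', f z') (x, f x) (z, f z)) as T2.
  rewrite (dist2_sym (x, f x) (z', f z')) in T1.
  rewrite (dist2_sym (x, f x) (z, f z)) in T2.
  assert (Hne : (z', f z') <> (u, f u)).
  { intro Heq. rewrite Heq in T1, Hz'.
    assert (dist2 (u, f u) (u, f u) = 0) by (rewrite dist2_euc; apply distance_refl).
    nra. }
  destruct (Htot _ _ HAz' HAu Hne) as [L|L]; [|contradiction].
  specialize (Hmon _ _ _ HAz' HAu HAz L Hlt).
  assert (c * dist2 (z', f z') (z, f z) <= c * (2 * rho)) by (apply Rmult_le_compat_l; lra).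
  nra.
Qed.

Lemma order_side_constant (f : R -> R) A lt c a b u z z' :
  continuity f -> strict_linear_order_on A lt -> 0 < c ->
  (forall p q r, A p -> A q -> A r -> lt p q -> lt q r -> dist2 p q <= c * dist2 p r) ->
  a < b ->
  (forall u v, a <= u -> u < v -> v <= b -> exists z, u < z < v /\ A (z, f z)) ->
  A (u, f u) -> A (z, f z) -> A (z', f z') ->
  a <= z <= b -> a <= z' <= b -> (u < z /\ u < z') \/ (z < u /\ z' < u) ->
  lt (u, f u) (z, f z) -> lt (u, f u) (z', f z').
Proof.
  intros cf Hord Hc Hmon Hab HD HAu HAz HAz' Hz Hz' Hside Hlt.
  (* [S] extends lying above the point over [u] from the dense set to all abscissae, so that
     chaining along a segment applies. *)
  set (S := fun x => exists del, 0 < del /\ forall w, A (w, f w) ->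
    Rabs (w - x) < del -> lt (u, f u) (w, f w)).
  assert (Hloc : forall x, a <= x <= b -> x <> u -> exists del, 0 < del /\
    forall s t, a <= s <= b -> Rabs (s - x) < del -> Rabs (t - x) < del -> S s -> S t).
  { intros x Hx Hxu.
    destruct (order_side_locally_constant f A lt c u x) as [d [Hd K]]; auto.
    exists d; split; [exact Hd|]. intros s t Hs Hsx Htx [d1 [Hd1 HS]].
    destruct (dense_near (fun w => A (w, f w)) a b Hab HD s (Rmin d1 (d - Rabs (s - x))) Hs)
      as [w [Hw [HAw Hws]]]; [apply Rmin_pos; lra|].
    pose proof (Rmin_l d1 (d - Rabs (s - x))). pose proof (Rmin_r d1 (d - Rabs (s - x))).
    exists (d - Rabs (t - x)); split; [lra|]. intros w' HAw' Hw'.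
    apply (K w w'); auto.
    - split_Rabs; lra.
    - split_Rabs; lra.
    - apply HS; [exact HAw|lra]. }
  assert (HSz : S z).
  { destruct (order_side_locally_constant f A lt c u z) as [d [Hd K]]; auto; [lra|].
    exists d; split; [exact Hd|]. intros w HAw Hw. apply (K z w); auto.
    rewrite Rminus_diag, Rabs_R0; exact Hd. }
  assert (Hchain : forall s t, s <= t -> a <= s -> t <= b -> (u < s \/ t < u) -> (S s <-> S t)).
  { intros s t Hst Hs Ht Hu. apply (interval_chain (fun s t => S s <-> S t)); auto.
    - intros; tauto.
    - intros x Hx. destruct (Hloc x) as [d [Hd K]]; [lra|lra|].
      exists d; split; [exact Hd|]. intros p q Hp Hq H1 H2 H3.
      split; apply K; lra || (split_Rabs; lra). }
  assert (HSz' : S z').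
  { destruct (Rle_dec z z') as [L|L].
    - apply (Hchain z z'); auto; lra.
    - apply (Hchain z' z); auto; lra. }
  destruct HSz' as [d [Hd K]]. apply K; [exact HAz'|].
  rewrite Rminus_diag, Rabs_R0; exact Hd.
Qed.

(* Connectedness forces the order witnessing monotonicity to agree with [<] or with [>] on the
   dense set; continuity then transfers the inequality to all points. *)
Lemma monotone_dense_graph (f : R -> R) A a b :
  continuity f -> monotone_set A -> a < b ->
  (forall u v, a <= u -> u < v -> v <= b -> exists z, u < z < v /\ A (z, f z)) ->
  exists c, 0 <= c /\ forall u y v, a <= u -> u < y -> y < v -> v <= b ->
    dist2 (u, f u) (y, f y) <= c * dist2 (u, f u) (v, f v).
Proof.
  intros cf [lt [c [Hord [Hc Hmon]]]] Hab HD.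
  assert (HDpt : forall u y v, A (u, f u) -> A (y, f y) -> A (v, f v) ->
    a <= u -> u < y -> y < v -> v <= b ->
    dist2 (u, f u) (y, f y) <= (c + 1) * dist2 (u, f u) (v, f v)).
  { intros u y v HAu HAy HAv Hu Huy Hyv Hv.
    pose proof Hord as [Hirr [Htr Htot]].
    assert (Hne : forall s t, s < t -> (s, f s) <> (t, f t)).
    { intros s t Hst Heq. injection Heq; lra. }
    pose proof (Rle_trans _ _ _ (Rabs_pos _) (proj1 (dist2_coord_le (u, f u) (v, f v)))).
    assert (Side : forall p q r, A (p, f p) -> A (q, f q) -> A (r, f r) ->
      a <= q <= b -> a <= r <= b -> (p < q /\ p < r) \/ (q < p /\ r < p) ->
      lt (p, f p) (q, f q) -> lt (p, f p) (r, f r)).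
    { intros p q r Hp Hq Hr Hqab Hrab. apply (order_side_constant f A lt c a b); auto. }
    destruct (Htot (u, f u) (v, f v)) as [L|L]; auto; [apply Hne; lra| |].
    - assert (L1 : lt (u, f u) (y, f y)) by (apply (Side u v y); auto; lra).
      assert (L2 : lt (y, f y) (v, f v)).
      (* With [v] below [y] in the order, [u], on the same side of [v] as [y], would also be above
         [v], against [L]. *)
      { destruct (Htot (y, f y) (v, f v)) as [L2|L2]; auto.
        exfalso. apply (Hirr (u, f u)); auto. apply Htr with (v, f v); auto.
        apply (Side v y u); auto; lra. }
      specialize (Hmon _ _ _ HAu HAy HAv L1 L2). lra.
    - assert (L1 : lt (v, f v) (y, f y)) by (apply (Side v u y); auto; lra).
      assert (L2 : lt (y, f y) (u, f u)).
      { destruct (Htot (y, f y) (u, f u)) as [L2|L2]; auto.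
        - intro Heq; apply (Hne u y Huy); auto.
        - exfalso. apply (Hirr (u, f u)); auto. apply Htr with (v, f v); auto.
          apply (Side u y v); auto; lra. }
      (* In the reversed order this bounds the distance from [v] to [y]; passing to [u] by the
         triangle inequality turns [c] into [c + 1]. *)
      specialize (Hmon _ _ _ HAv HAy HAu L1 L2).
      pose proof (dist2_triangle (u, f u) (v, f v) (y, f y)).
      rewrite (dist2_sym (v, f v) (u, f u)) in Hmon. lra. }
  exists (c + 1); split; [lra|]. intros u y v Hu Huy Hyv Hv.
  apply le_epsilon. intros eps He.
  (* Approximation costs [2 * r] on the left and [(c + 1) * (2 * r)] on the right. *)
  set (r := eps / (2 * c + 4)).
  assert (Hr : 0 < r) by (apply Rdiv_lt_0_compat; lra).
  assert (Hr2 : r * (2 * c + 4) = eps) by (unfold r; field; lra).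
  assert (Happ : forall x s t, s < t -> a <= s -> t <= b -> s <= x <= t ->
    exists w, A (w, f w) /\ s < w < t /\ dist2 (w, f w) (x, f x) < r).
  { intros x s t Hst Hs Ht Hx.
    destruct (graph_point_continuous f cf x r Hr) as [d [Hd K]].
    destruct (dense_near (fun w => s < w < t /\ A (w, f w)) s t Hst) with (x := x) (eta := d)
      as [w [_ [[Hw HAw] Hwx]]]; auto.
    - intros p q Hp Hpq Hq. destruct (HD p q) as [w [Hw HAw]]; try lra.
      exists w; split; [exact Hw|]. split; [lra|exact HAw].
    - exists w; auto. }
  (* Half of the smaller gap keeps [u' < y' < v']. *)
  set (m := Rmin (y - u) (v - y) / 2).
  assert (Hm : 0 < Rmin (y - u) (v - y)) by (apply Rmin_pos; lra).
  pose proof (Rmin_l (y - u) (v - y)). pose proof (Rmin_r (y - u) (v - y)).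
  destruct (Happ u u (u + m)) as [u' [HAu [Hu' Du]]]; unfold m in *; try lra.
  destruct (Happ y y (y + m)) as [y' [HAy [Hy' Dy]]]; unfold m in *; try lra.
  destruct (Happ v (v - m) v) as [v' [HAv [Hv' Dv]]]; unfold m in *; try lra.
  pose proof (HDpt u' y' v' HAu HAy HAv ltac:(lra) ltac:(lra) ltac:(lra) ltac:(lra)) as Key.
  pose proof (dist2_triangle (u, f u) (u', f u') (y, f y)) as T1.
  pose proof (dist2_triangle (u', f u') (y', f y') (y, f y)) as T2.
  pose proof (dist2_triangle (u', f u') (u, f u) (v', f v')) as T3.
  pose proof (dist2_triangle (u, f u) (v, f v) (v', f v')) as T4.
  rewrite (dist2_sym (u, f u) (u', f u')) in T1.
  rewrite (dist2_sym (v, f v) (v', f v')) in T4.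
  assert ((c + 1) * dist2 (u', f u') (v', f v')
    <= (c + 1) * (dist2 (u, f u) (v, f v) + 2 * r)) by (apply Rmult_le_compat_l; lra).
  nra.
Qed.

(** * Passage between the interval and the whole line *)

(** As [u] may be an end point of [I], the segment is taken on one side of it, towards a point of
    [I] other than [u]. *)
Lemma rel_open_contains_segment (I U : R -> Prop) :
  is_interval I -> nondegenerate I -> rel_open I U -> (exists u, U u) ->
  exists a b, a < b /\ forall x, a < x < b -> U x.
Proof.
  intros HI [p [q [Hpq [Hp Hq]]]] [HUI HU] [u Hu].
  destruct (HU u Hu) as [eps [He K]].
  destruct (Rle_dec u p) as [L|L].
  - exists u, (Rmin q (u + eps)). split; [apply Rmin_glb_lt; lra|].
    intros x Hx. pose proof (Rmin_l q (u + eps)). pose proof (Rmin_r q (u + eps)).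
    apply K; [apply (HI u x q); auto; lra|split_Rabs; lra].
  - exists (Rmax p (u - eps)), u. split; [apply Rmax_lub_lt; lra|].
    intros x Hx. pose proof (Rmax_l p (u - eps)). pose proof (Rmax_r p (u - eps)).
    apply K; [apply (HI p x u); auto; lra|split_Rabs; lra].
Qed.

Lemma continuity_clamp (I : R -> Prop) (f : R -> R) a b :
  continuous_on I f -> a <= b -> (forall x, a <= x <= b -> I x) ->
  continuity (fun x => f (clamp a b x)).
Proof.
  intros cf Hab HI. apply continuity_eps. intros x eps He.
  pose proof (clamp_in a b x Hab) as Hx.
  pose proof (cf _ (HI _ Hx)) as Hc.
  assert (Hb : locally (f (clamp a b x)) (ball (f (clamp a b x)) (mkposreal eps He))).
  { apply locally_ball. }
  destruct (Hc _ Hb) as [d Hd]. exists d; split; [apply cond_pos|].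
  intros y Hy. apply Hd.
  - apply Rle_lt_trans with (2 := Hy), clamp_lipschitz.
  - apply HI, clamp_in, Hab.
Qed.

Lemma has_ext_derivative_on_of_clamp (I : R -> Prop) (f : R -> R) a b x (l : Rbar) :
  a < x < b ->
  is_lim (fun y => (f (clamp a b y) - f (clamp a b x)) / (y - x)) x l ->
  has_ext_derivative_on I f x.
Proof.
  intros Hx Hl. exists l. intros Q HQ. destruct (Hl Q HQ) as [d Hd].
  assert (Hm : 0 < Rmin d (Rmin (x - a) (b - x))).
  { repeat apply Rmin_pos; try lra. apply cond_pos. }
  exists (mkposreal _ Hm). intros y Hy [_ Hyx].
  assert (Hy' : Rabs (y - x) < Rmin d (Rmin (x - a) (b - x))) by exact Hy.
  pose proof (Rmin_l d (Rmin (x - a) (b - x))). pose proof (Rmin_r d (Rmin (x - a) (b - x))).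
  pose proof (Rmin_l (x - a) (b - x)). pose proof (Rmin_r (x - a) (b - x)).
  assert (Hball : ball x d y) by (change (Rabs (y - x) < d); lra).
  specialize (Hd y Hball Hyx).
  rewrite !clamp_id in Hd by (split_Rabs; lra). exact Hd.
Qed.

Theorem theorem4p5 (I : R -> Prop) (f : R -> R) :
  is_interval I -> nondegenerate I ->
  continuous_on I f ->
  sigma_monotone (graph_on I f) ->
  forall U : R -> Prop, rel_open I U -> (exists u, U u) ->
    exists P : R -> Prop, perfect_set P /\
      forall x, P x -> U x /\ has_ext_derivative_on I f x.
Proof.
  intros HI Hnd cf [A [HA HAI]] U HU HUne.
  destruct (rel_open_contains_segment I U HI Hnd HU HUne) as [a0 [b0 [Hab0 HabU]]].
  assert (HUI : forall x, U x -> I x) by apply HU.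
  destruct (baire_interval (fun n x => A n (x, f x)) a0 b0 Hab0) as [n [a [b [Ha [Hab [Hb HD]]]]]].
  { intros x Hx. apply HAI. split; [apply HUI, HabU; exact Hx|reflexivity]. }
  (* [f] is continuous only relative to [I]; freezing it outside [[a, b]] gives a function
     continuous on the line. *)
  set (g := fun x => f (clamp a b x)).
  assert (Hg : forall x, a <= x <= b -> g x = f x).
  { intros x Hx. unfold g. rewrite clamp_id; auto. }
  assert (cg : continuity g).
  { apply continuity_clamp with I; auto; [lra|]. intros x Hx. apply HUI, HabU; lra. }
  destruct (monotone_dense_graph g (A n) a b cg (HA n) Hab) as [c [Hc Hmon]].
  { intros u v Hu Huv Hv. destruct (HD u v Hu Huv Hv) as [z [Hz HAz]].
    exists z; split; [exact Hz|]. rewrite Hg by lra; exact HAz. }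
  destruct (perfect_differentiability g a b c cg Hab Hc) as [P [HP1 HP2]].
  { intros u y v Hu Huy Hyv Hv Heq.
    specialize (Hmon u y v Hu Huy Hyv Hv).
    pose proof (proj2 (dist2_coord_le (u, g u) (y, g y))) as H1; simpl in H1.
    (* A chord with equal end values is horizontal, so the Euclidean inequality becomes the chord
       condition. *)
    assert (H2 : dist2 (u, g u) (v, g v) <= v - u).
    { apply Rle_trans with (1 := dist2_le_sum _ _). simpl.
      rewrite Heq, Rminus_diag, Rabs_R0. split_Rabs; lra. }
    apply (Rmult_le_compat_l c) in H2; [|exact Hc].
    rewrite Rabs_minus_sym. lra. }
  exists P; split; [exact HP1|]. intros x HPx. destruct (HP2 x HPx) as [Hx [l Hl]].
  split; [apply HabU; lra|].
  apply has_ext_derivative_on_of_clamp with a b l; auto.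
Qed.
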